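(* Let $g \geq 1$ be an integer, let $r\ge 3$ be an odd integer, and let $\zeta=e^{2\pi i/r}$. If $r$ is prime, then the $\mathbb{Z}[\zeta]$-lattice $V'_g=\langle\mathcal{B}^{v'}_g\rangle_{\mathbb{Z}[\zeta]}\subset V_g$ is invariant under the action $\varphi_g$ of the Heisenberg group $\mathbb{H}_g$ and under the projective action $\psi_g$ of the mapping class group $\mathrm{Mod}(\Sigma_g)$; that is, $\varphi_g(x)(V'_g)=V'_g$ for every $x\in\mathbb{H}_g$, and for every $f\in\mathrm{Mod}(\Sigma_g)$ the class $\psi_g(f)\in\mathrm{PGL}_{\mathbb{Q}(\zeta)}(V_g)$ has a representative mapping $V'_g$ onto itself.
   Context: **Quantum binomials.** $[n]_q=\frac{q^n-q^{-n}}{q-q^{-1}}$, $[k]_q!=\prod_{j=1}^k[j]_q$, and $\left[\begin{smallmatrix}k\\ \ell\end{smallmatrix}\right]_q=\frac{[k]_q!}{[\ell]_q!\,[k-\ell]_q!}\in\mathbb{Z}[q,q^{-1}]$ for $0\le\ell\le k$; a subscript $\zeta$ means evaluation at $q=\zeta$. **Heisenberg group.** $\mathbb{H}_g$ is generated by $\sigma,\alpha_j,\beta_j$ ($1\le j\le g$) with relations: $\sigma$ is central, $[\alpha_j,\alpha_k]=[\beta_j,\beta_k]=1$, $[\alpha_j,\beta_k]=\sigma^{-2\delta_{j,k}}$. **Schrödinger representation.** $V_g$ is the $\mathbb{Q}(\zeta)$-vector space with basis $v_{n_1}\otimes\cdots\otimes v_{n_g}$, $(n_1,\dots,n_g)\in(\mathbb{Z}/r\mathbb{Z})^{g}$,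 so $V_g=V_1^{\otimes g}$. The action $\varphi_g$ of $\mathbb{H}_g$ on $V_g$: $\sigma$ acts by the scalar $-\zeta^{-2}$; $\alpha_j$ acts on the $j$-th tensor factor by $v_n\mapsto\zeta^{4n}v_n$; $\beta_j$ acts on the $j$-th tensor factor by $v_n\mapsto v_{n+1}$. **Mapping class group.** $\Sigma_g$ is a connected oriented surface of genus $g$ with one boundary component, and $\mathrm{Mod}(\Sigma_g)$ is its mapping class group (diffeomorphisms and isotopies fix the boundary pointwise). It is generated by positive Dehn twists $\tau_{\alpha_j},\tau_{\beta_j}$ ($1\le j\le g$), $\tau_{\gamma_k}$ ($1\le k\le g-1$) along the standard Lickorish curves: viewing $\Sigma_g$ as a linearly ordered boundary connected sum of $g$ one-holed tori, $\alpha_j,\beta_j$ are simple closed curves in the $j$-th torus meeting once, and $\gamma_k$ meets each of $\beta_k$ and $\beta_{k+1}$ once, is disjoint from the other curves, and cobounds a pair of pants with $\alpha_k$ and $\alpha_{k+1}$. **Projective representation.** Let $G_1=\sum_{\ell=0}^{r-1}\zeta^{-2\ell(\ell-1)}$. The homomorphism $\psi_g:\mathrm{Mod}(\Sigma_g)\to\mathrm{PGL}_{\mathbb{Q}(\zeta)}(V_g)$ (known to be well defined) is determined by the following representatives for the generators (each acting as the identity on the tensor factors not mentioned): - $\tau_{\alpha_j}$ acts on the $j$-th factor by $v_n\mapsto\zeta^{2(n+1)n}v_n$; - $\tau_{\beta_j}$ acts on the $j$-th factor by $v_n\mapsto\frac1{G_1}\sum_{m=0}^{r-1}\zeta^{-2(m-n+1)(m-n)}v_m$;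 - $\tau_{\gamma_k}$ acts on the $k$-th and $(k+1)$-st factors by $v_{n_1}\otimes v_{n_2}\mapsto\zeta^{2(n_1-n_2+1)(n_1-n_2)}v_{n_1}\otimes v_{n_2}$. **The basis.** For $0\le n\le r-1$ set $t_n=\sum_{k=0}^n(-1)^{n-k}\zeta^{(n-k)(n-1)}\left[\begin{smallmatrix}n\\k\end{smallmatrix}\right]_\zeta v_k\in V_1$. For $\boldsymbol{n}=(n_1,\dots,n_g)$ with $0\le n_j\le r-1$ set $$\boldsymbol{v}'_{\boldsymbol{n}}=(1-\zeta)^{-\left\lfloor\frac{n_1+\cdots+n_g}{2}\right\rfloor}\,t_{n_1}\otimes\cdots\otimes t_{n_g},$$ and $\mathcal{B}^{v'}_g=\{\boldsymbol{v}'_{\boldsymbol{n}}\mid 0\le n_j\le r-1\ \forall\,1\le j\le g\}$. *)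

(* Defs.v *)
From HB Require Import structures.
From mathcomp Require Import all_boot all_order all_algebra.
From mathcomp Require Import complex.
From mathcomp Require Import all_classical all_reals all_analysis.

Set Implicit Arguments.
Unset Strict Implicit.
Unset Printing Implicit Defensive.

Import Order.TTheory GRing.Theory Num.Theory.
Import numFieldNormedType.Exports.

Local Open Scope classical_set_scope.
Local Open Scope quotient_scope.
Local Open Scope ring_scope.

(* Operations on [pg_sort] satisfying the group axioms up to the congruence
   [pg_eq]; [quot_group] is the resulting group of equivalence classes. *)
Record pregroup := PreGroup {
  pg_sort : choiceType;
  pg_eq : pg_sort -> pg_sort -> Prop;
  pg_one : pg_sort;
  pg_mul : pg_sort -> pg_sort -> pg_sort;
  pg_inv : pg_sort -> pg_sort;
  pg_refl : forall x, pg_eq x x;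
  pg_sym : forall x y, pg_eq x y -> pg_eq y x;
  pg_trans : forall x y z, pg_eq x y -> pg_eq y z -> pg_eq x z;
  pg_eq_mul : forall x x' y y',
    pg_eq x x' -> pg_eq y y' -> pg_eq (pg_mul x y) (pg_mul x' y');
  pg_eq_inv : forall x x', pg_eq x x' -> pg_eq (pg_inv x) (pg_inv x');
  pg_mulA : forall x y z,
    pg_eq (pg_mul x (pg_mul y z)) (pg_mul (pg_mul x y) z);
  pg_mul1 : forall x, pg_eq (pg_mul pg_one x) x;
  pg_1mul : forall x, pg_eq (pg_mul x pg_one) x;
  pg_mulV : forall x, pg_eq (pg_mul (pg_inv x) x) pg_one;
  pg_Vmul : forall x, pg_eq (pg_mul x (pg_inv x)) pg_one
}.

Section QuotGroup.
Variable P : pregroup.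

Definition pg_rel (x y : pg_sort P) : bool := `[< pg_eq x y >].

Lemma pg_rel_refl : reflexive pg_rel.
Proof. by move=> x; apply/asboolP; exact: pg_refl. Qed.

Lemma pg_rel_sym : symmetric pg_rel.
Proof. by move=> x y; apply/asboolP/asboolP; exact: pg_sym. Qed.

Lemma pg_rel_trans : transitive pg_rel.
Proof.
by move=> y x z /asboolP xy /asboolP yz; apply/asboolP; exact: pg_trans yz.
Qed.

Definition pg_equiv := EquivRel pg_rel pg_rel_refl pg_rel_sym pg_rel_trans.

Definition quot_group := {eq_quot pg_equiv}.
HB.instance Definition _ := Choice.on quot_group.
HB.instance Definition _ := Quotient.on quot_group.

Definition pg_class (x : pg_sort P) : quot_group := \pi_quot_group x.

Lemma pg_classP x y : pg_class x = pg_class y <-> pg_eq x y.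
Proof.
split=> [e|e]; first by apply/asboolP; have /eqmodP := e.
by apply/eqmodP/asboolP.
Qed.

Lemma pg_classK (a : quot_group) : pg_class (repr a) = a.
Proof. exact: reprK. Qed.

Lemma pg_repr_class x : pg_eq (repr (pg_class x)) x.
Proof. by apply/pg_classP; rewrite pg_classK. Qed.

Let qone : quot_group := pg_class (pg_one P).
Let qmul (a b : quot_group) : quot_group := pg_class (pg_mul (repr a) (repr b)).
Let qinv (a : quot_group) : quot_group := pg_class (pg_inv (repr a)).

Let qmulE x y : qmul (pg_class x) (pg_class y) = pg_class (pg_mul x y).
Proof. by apply/pg_classP; apply: pg_eq_mul; exact: pg_repr_class. Qed.

Let qinvE x : qinv (pg_class x) = pg_class (pg_inv x).
Proof. by apply/pg_classP; apply: pg_eq_inv; exact: pg_repr_class. Qed.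

Let qmulA : associative qmul.
Proof.
move=> a b c; rewrite -(pg_classK a) -(pg_classK b) -(pg_classK c) !qmulE.
by apply/pg_classP; exact: pg_mulA.
Qed.

Let qmul1 : left_id qone qmul.
Proof. by move=> a; rewrite -(pg_classK a) qmulE; apply/pg_classP/pg_mul1. Qed.

Let q1mul : right_id qone qmul.
Proof. by move=> a; rewrite -(pg_classK a) qmulE; apply/pg_classP/pg_1mul. Qed.

Let qmulV : left_inverse qone qinv qmul.
Proof.
by move=> a; rewrite -(pg_classK a) qinvE qmulE; apply/pg_classP/pg_mulV.
Qed.

Let qVmul : right_inverse qone qinv qmul.
Proof.
by move=> a; rewrite -(pg_classK a) qinvE qmulE; apply/pg_classP/pg_Vmul.
Qed.

HB.instance Definition _ :=
  isGroup.Build quot_group qmulA qmul1 q1mul qmulV qVmul.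

Lemma pg_classM x y : pg_class (pg_mul x y) = (pg_class x * pg_class y)%g.
Proof. by rewrite -qmulE. Qed.

Lemma pg_classV x : pg_class (pg_inv x) = ((pg_class x)^-1)%g.
Proof. by rewrite -qinvE. Qed.

End QuotGroup.

Definition generated_by (G : groupType) (A : set G) : Prop :=
  forall S : set G, S 1%g -> (forall x y, S x -> S y -> S (x * y)%g) ->
    (forall x, S x -> S (x^-1)%g) -> A `<=` S -> S = setT.

Section HeisenbergGroup.
Variable g : nat.

Inductive heis_gen := heis_sigma | heis_alpha of 'I_g | heis_beta of 'I_g.

Inductive heis_term :=
  | HGen of heis_gen
  | HOne
  | HMul of heis_term & heis_term
  | HInv of heis_term.

HB.instance Definition _ := gen_eqMixin heis_term.
HB.instance Definition _ := gen_choiceMixin heis_term.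

Local Notation s := (HGen heis_sigma).
Local Notation a j := (HGen (heis_alpha j)).
Local Notation b j := (HGen (heis_beta j)).

Definition HComm (x y : heis_term) := HMul (HMul x y) (HMul (HInv x) (HInv y)).

Inductive heis_relator : heis_term -> heis_term -> Prop :=
  | hr_central x : heis_relator (HComm s (HGen x)) HOne
  | hr_alpha j k : heis_relator (HComm (a j) (a k)) HOne
  | hr_beta j k : heis_relator (HComm (b j) (b k)) HOne
  | hr_same j : heis_relator (HComm (a j) (b j)) (HInv (HMul s s))
  | hr_diff j k : j != k -> heis_relator (HComm (a j) (b k)) HOne.

Inductive heis_eq : heis_term -> heis_term -> Prop :=
  | he_rel x y : heis_relator x y -> heis_eq x y
  | he_refl x : heis_eq x x
  | he_sym x y : heis_eq x y -> heis_eq y x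
  | he_trans x y z : heis_eq x y -> heis_eq y z -> heis_eq x z
  | he_mul x x' y y' :
      heis_eq x x' -> heis_eq y y' -> heis_eq (HMul x y) (HMul x' y')
  | he_inv x x' : heis_eq x x' -> heis_eq (HInv x) (HInv x')
  | he_mulA x y z : heis_eq (HMul x (HMul y z)) (HMul (HMul x y) z)
  | he_mul1 x : heis_eq (HMul HOne x) x
  | he_1mul x : heis_eq (HMul x HOne) x
  | he_mulV x : heis_eq (HMul (HInv x) x) HOne
  | he_Vmul x : heis_eq (HMul x (HInv x)) HOne.

Definition heis_pregroup : pregroup :=
  @PreGroup heis_term heis_eq HOne HMul HInv
    he_refl he_sym he_trans he_mul he_inv he_mulA he_mul1 he_1mul
    he_mulV he_Vmul.

Definition Heis : groupType := quot_group heis_pregroup.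

Definition hsigma : Heis := @pg_class heis_pregroup s.
Definition halpha (j : 'I_g) : Heis := @pg_class heis_pregroup (a j).
Definition hbeta (j : 'I_g) : Heis := @pg_class heis_pregroup (b j).

End HeisenbergGroup.

Section Surface.
Variables (R : realType) (g : nat).

(* The genus g surface with one boundary component is obtained by gluing g
   vertical strips [0,1] x R, each rolled up by y ~ y + 4.  Strips and curves are
   numbered from 0.  Along the edges x = 0 and x = 1:
   - for 0 <= y <= 1 the two edges of each strip are glued together; the circle
     at height 1/2 of strip j is alpha_j, the circle x = 1/2 is beta_j, and the
     two cross once, in a one-holed torus;
   - strips k and k+1 are glued into one cylinder of circumference 2 for y in
     [1, 2] (k even) or [-1, 0] (k odd); its core is gamma_k.  It meets beta_k
     and beta_{k+1} once each, and bounds with alpha_k and alpha_{k+1} the pair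
     of pants made of the parts of strips k, k+1 between these three curves
     (the four edge points at height 1, resp. 0, become one interior point);
   - the rest of the edges is free.
   The Euler characteristic is 1 - 2g, the free edges form a single circle, and
   since right edges are only glued to left edges, at equal height, the
   orientation dx dy of the strips orients the surface. *)

Definition clamp01 (x : R) : R := Num.max 0 (Num.min 1 x).

Lemma clamp01P x : clamp01 x \in `[0, 1].
Proof.
by rewrite in_itv /= /clamp01 le_max lexx /= ge_max ler01 /= ge_min lexx.
Qed.

Definition unit_itv : set R := `[0, 1].

Lemma clamp01_mem x : clamp01 x \in unit_itv.
Proof. by rewrite inE /=; exact: clamp01P. Qed.

Definition strips := {j : 'I_g & (unit_itv * R)%type}.

(* The coordinate x is meant to be in [0,1]; other values are clamped. *)
Definition strip_pt (j : 'I_g) (x y : R) : strips :=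
  existT (fun _ => (unit_itv * R)%type) j
    (exist (fun u => u \in unit_itv) (clamp01 x) (clamp01_mem x), y).

Definition gamma_height (k : 'I_g) : R := if odd k then -1 else 1.

Inductive glue : strips -> strips -> Prop :=
  | glue_period j x y : glue (strip_pt j x y) (strip_pt j x (y + 4))
  | glue_alpha j y : 0 <= y <= 1 -> glue (strip_pt j 1 y) (strip_pt j 0 y)
  | glue_gamma_mid (k l : 'I_g) y : l = k.+1 :> nat ->
      gamma_height k <= y <= gamma_height k + 1 ->
      glue (strip_pt k 1 y) (strip_pt l 0 y)
  | glue_gamma_out (k l : 'I_g) y : l = k.+1 :> nat ->
      gamma_height k <= y <= gamma_height k + 1 ->
      glue (strip_pt l 1 y) (strip_pt k 0 y).

Inductive glued : strips -> strips -> Prop :=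
  | glued_step p q : glue p q -> glued p q
  | glued_refl p : glued p p
  | glued_sym p q : glued p q -> glued q p
  | glued_trans p q t : glued p q -> glued q t -> glued p t.

Definition glued_rel (p q : strips) : bool := `[< glued p q >].

Lemma glued_rel_refl : reflexive glued_rel.
Proof. by move=> p; apply/asboolP; exact: glued_refl. Qed.

Lemma glued_rel_sym : symmetric glued_rel.
Proof. by move=> p q; apply/asboolP/asboolP; exact: glued_sym. Qed.

Lemma glued_rel_trans : transitive glued_rel.
Proof.
by move=> q p t /asboolP pq /asboolP qt; apply/asboolP; exact: glued_trans qt.
Qed.

Definition glued_equiv :=
  EquivRel glued_rel glued_rel_refl glued_rel_sym glued_rel_trans.

Definition surface := {eq_quot glued_equiv}.
HB.instance Definition _ := Topological.copy surface (quotient_topology surface).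
HB.instance Definition _ := Quotient.on surface.

Definition surf_pt (j : 'I_g) (x y : R) : surface := \pi_surface (strip_pt j x y).

Definition free_edge : set strips := [set p |
  (\val (projT2 p).1 = 0 \/ \val (projT2 p).1 = 1) /\
  forall q, glued p q ->
    projT1 q = projT1 p /\ \val (projT2 q).1 = \val (projT2 p).1].

Definition surface_boundary : set surface :=
  closure ((fun p => \pi_surface p) @` free_edge).

(* In dimension 2, homeomorphisms up to isotopy give the same mapping class
   group as diffeomorphisms up to smooth isotopy.  Homeomorphisms fixing the
   boundary circle pointwise preserve the orientation. *)
Record homeo := Homeo {
  homeo_fun :> surface -> surface;
  homeo_inv : surface -> surface;
  homeo_continuous : continuous homeo_fun;
  homeo_inv_continuous : continuous homeo_inv;
  homeo_funK : cancel homeo_fun homeo_inv;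
  homeo_invK : cancel homeo_inv homeo_fun;
  homeo_boundary : forall p, surface_boundary p -> homeo_fun p = p
}.

HB.instance Definition _ := gen_eqMixin homeo.
HB.instance Definition _ := gen_choiceMixin homeo.

Definition isotopic (f h : homeo) : Prop := exists H : R -> homeo,
  [/\ {within `[0, 1] `*` setT,
        continuous (fun tp : R * surface => H tp.1 tp.2)},
      H 0 =1 f & H 1 =1 h].

Definition homeo_one : homeo.
Proof. by exists id id => //; move=> x; exact: cvg_id. Defined.

Definition homeo_mul (f h : homeo) : homeo.
Proof.
exists (f \o h) (homeo_inv h \o homeo_inv f).
- by move=> x; apply: continuous_comp; exact: homeo_continuous.
- by move=> x; apply: continuous_comp; exact: homeo_inv_continuous.
- by move=> x /=; rewrite !homeo_funK.
- by move=> x /=; rewrite !homeo_invK.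
- by move=> x bx /=; rewrite !homeo_boundary.
Defined.

Definition homeo_Inv (f : homeo) : homeo.
Proof.
exists (homeo_inv f) f.
- exact: homeo_inv_continuous.
- exact: homeo_continuous.
- exact: homeo_invK.
- exact: homeo_funK.
- by move=> x bx; rewrite -{1}(homeo_boundary f bx) homeo_funK.
Defined.

Lemma isotopic_eq (f h : homeo) : f =1 h -> isotopic f h.
Proof.
move=> e; exists (fun=> f); split=> //.
apply: continuous_subspaceT => -[t p].
by apply: (@continuous_comp _ _ _ snd f); [exact: cvg_snd|exact: homeo_continuous].
Qed.

Lemma within_precomp (X Y Z : topologicalType) (A : set X) (B : set Y)
    (u : X -> Y) (f : Y -> Z) :
  continuous u -> (forall x, A x -> B (u x)) ->
  {within B, continuous f} -> {within A, continuous (f \o u)}.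
Proof.
move=> /continuousP cu uAB /continuousP cf; apply/continuousP => W oW.
have /open_subspaceP[V oV VE] := cf _ oW.
apply/open_subspaceP; exists (u @^-1` V); first exact: cu.
apply/seteqP; split=> x /= [Ux Ax]; split=> //.
- have : (V `&` B) (u x) by split=> //; exact: uAB.
  by rewrite VE => -[].
- have : (f @^-1` W `&` B) (u x) by split=> //; exact: uAB.
  by rewrite -VE => -[].
Qed.

Lemma reparam_continuous (v : R -> R) (b : surface -> surface) :
  continuous v -> continuous b ->
  continuous (fun tp : R * surface => (v tp.1, b tp.2)).
Proof.
move=> cv cb [t p] U [[V W] /= [nV nW] VWU].
exists (v @^-1` V, b @^-1` W) => /=; first by split; [exact: cv|exact: cb].
by move=> [t' p'] [/= Vt Wp]; exact: VWU.
Qed.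

Lemma isotopic_comp (f h a b : homeo) : isotopic f h ->
  isotopic (homeo_mul a (homeo_mul f b)) (homeo_mul a (homeo_mul h b)).
Proof.
case=> H [cH H0 H1]; exists (fun t => homeo_mul a (homeo_mul (H t) b)); split.
- have cb : {within `[0, 1] `*` [set: surface],
      continuous ((fun tp : R * surface => H tp.1 tp.2) \o
                  (fun tp : R * surface => (tp.1, b tp.2)))}.
    apply: within_precomp cH; last by move=> tp [].
    apply: (@reparam_continuous id) => t; first exact: cvg_id.
    exact: homeo_continuous.
  apply: (@within_continuous_comp _ _ _ _ _ (homeo_fun a) _ cb) => p _.
  exact: homeo_continuous.
- by move=> p; congr (a _); exact: H0.
- by move=> p; congr (a _); exact: H1.
Qed.

Lemma isotopic_sym f h : isotopic f h -> isotopic h f.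
Proof.
case=> H [cH H0 H1]; exists (fun t => H (1 - t)); split.
- apply: (within_precomp (u := fun tp : R * surface => (1 - tp.1, tp.2)) _ _ cH).
    apply: (reparam_continuous (v := fun t => 1 - t) (b := id)) => [t|p].
      by apply: cvgB; [exact: cvg_cst|exact: cvg_id].
    exact: cvg_id.
  move=> [t p] [] /=; rewrite !in_itv /= => /andP[t0 t1] _; split=> //=.
  by rewrite subr_ge0 t1 gerBl t0.
- by move=> p; rewrite subr0.
- by move=> p; rewrite subrr.
Qed.

Lemma isotopic_trans f h k : isotopic f h -> isotopic h k -> isotopic f k.
Proof.
case=> H [cH H0 H1] [K [cK K0 K1]].
pose L t := if t <= 2^-1 then H (2 * t) else K (2 * t - 1).
have h2 : (0 : R) < 2^-1 by rewrite invr_gt0.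
exists L; split; last 2 first.
- by move=> p; rewrite /L ltW// mulr0.
- by move=> p; rewrite /L leNgt invf_lt1// ltr1n /= mulr1 -[2]/(1 + 1) addrK.
pose A : set (R * surface) := fst @^-1` `[0, 2^-1].
pose B : set (R * surface) := fst @^-1` `[2^-1, 1].
have cF : continuous (@fst R surface) by move=> p; exact: cvg_fst.
have cA : closed A by apply: preimage_closed => //; exact: itv_closed.
have cB : closed B by apply: preimage_closed => //; exact: itv_closed.
have -> : `[0, 1] `*` [set: surface] = A `|` B.
  apply/seteqP; split=> -[t p]; rewrite /A /B /= !in_itv /=.
    case=> /andP[t0 t1] _; have [tl|/ltW tg] := leP t 2^-1.
      by left; rewrite t0.
    by right; rewrite t1 andbT.
  have h21 : (2^-1 : R) <= 1 by rewrite invf_le1// ler1n.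
  case=> /andP[t0 t1]; split=> //.
    by rewrite t0 (le_trans t1).
  by rewrite t1 (le_trans _ t0)// ltW.
apply: withinU_continuous => //.
- have : {within A, continuous ((fun tp : R * surface => H tp.1 tp.2) \o
                   (fun tp : R * surface => (2 * tp.1, tp.2)))}.
    apply: within_precomp cH.
      apply: (reparam_continuous (v := fun t => 2 * t) (b := id)) => [t|p].
        by apply: cvgM; [exact: cvg_cst|exact: cvg_id].
      exact: cvg_id.
    move=> [t p]; rewrite /A /= !in_itv /= => /andP[t0 t1]; split=> //=.
    by rewrite mulr_ge0//= mulrC -ler_pdivlMr// mul1r.
  apply: subspace_eq_continuous => -[t p].
  by rewrite inE /A /= in_itv /= => /andP[_ t1]; rewrite /from_subspace /L t1.
- have : {within B, continuous ((fun tp : R * surface => K tp.1 tp.2) \o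
                   (fun tp : R * surface => (2 * tp.1 - 1, tp.2)))}.
    apply: within_precomp cK.
      apply: (reparam_continuous (v := fun t => 2 * t - 1) (b := id)) => [t|p].
        apply: cvgB; last exact: cvg_cst.
        by apply: cvgM; [exact: cvg_cst|exact: cvg_id].
      exact: cvg_id.
    move=> [t p]; rewrite /B /= !in_itv /= => /andP[t0 t1]; split=> //=.
    rewrite subr_ge0 lerBlDr -[1 + 1]/2 mulrC -ler_pdivrMr// mul1r t0 /=.
    by rewrite -ler_pdivlMr// mulfV.
  apply: subspace_eq_continuous => -[t p].
  rewrite inE /B /= in_itv /= => /andP[t0 t1]; rewrite /from_subspace /L.
  case: ifPn => // tl; have -> : t = 2^-1 by apply/eqP; rewrite eq_le tl t0.
  by rewrite /= mulfV// subrr H1 K0.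
Qed.

Lemma isotopic_mul f f' h h' : isotopic f f' -> isotopic h h' ->
  isotopic (homeo_mul f h) (homeo_mul f' h').
Proof.
move=> ff hh; apply: (@isotopic_trans _ (homeo_mul f' h)).
- have := isotopic_comp homeo_one h ff.
  by move=> i; apply: isotopic_trans (isotopic_trans i _); exact: isotopic_eq.
- have := isotopic_comp f' homeo_one hh.
  by move=> i; apply: isotopic_trans (isotopic_trans i _); exact: isotopic_eq.
Qed.

Lemma isotopic_Inv f h : isotopic f h -> isotopic (homeo_Inv f) (homeo_Inv h).
Proof.
move=> /(isotopic_comp (homeo_Inv f) (homeo_Inv h)) i; apply: isotopic_sym.
apply: isotopic_trans (isotopic_trans i _); apply: isotopic_eq => p /=.
- by rewrite homeo_funK.
- by rewrite homeo_invK.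
Qed.

Definition mod_pregroup : pregroup.
Proof.
exists homeo isotopic homeo_one homeo_mul homeo_Inv.
- by move=> f; exact: isotopic_eq.
- exact: isotopic_sym.
- exact: isotopic_trans.
- exact: isotopic_mul.
- exact: isotopic_Inv.
- by move=> f h k; exact: isotopic_eq.
- by move=> f; exact: isotopic_eq.
- by move=> f; exact: isotopic_eq.
- by move=> f; apply: isotopic_eq => p /=; rewrite homeo_funK.
- by move=> f; apply: isotopic_eq => p /=; rewrite homeo_invK.
Defined.

Definition Mod : groupType := quot_group mod_pregroup.

Definition mapping_class (f : homeo) : Mod := @pg_class mod_pregroup f.

(* Annuli: maps A(s, t), 1-periodic in s and embedded on R/Z x [0,1], whose core
   A(-, 1/2) is the given curve; ds dt is sent to the orientation dx dy. *)

Definition frac (s : R) : R := s - (Num.floor s)%:~R.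

Definition alpha_annulus (j : 'I_g) (s t : R) : surface :=
  surf_pt j (frac s) ((1 + 2 * t) / 4).

Definition beta_annulus (j : 'I_g) (s t : R) : surface :=
  surf_pt j ((3 - 2 * t) / 4) (4 * s).

(* For l = k + 1. *)
Definition gamma_annulus (k l : 'I_g) (s t : R) : surface :=
  let x := 2 * frac s in let y := gamma_height k + (1 + 2 * t) / 4 in
  if x <= 1 then surf_pt k x y else surf_pt l (x - 1) y.

(* f is the twist (s, t) |-> (s + t, t) on the annulus, and the identity
   outside.  This turns to the right when the core is crossed.  The opposite
   convention amounts to conjugating by the orientation-reversing involution
   x |-> 1 - x of all strips, which preserves each of the curves. *)
Definition is_dehn_twist (A : R -> R -> surface) (f : surface -> surface) :=
  (forall s t, 0 <= t <= 1 -> f (A s t) = A (s + t) t) /\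
  (forall p, (forall s t, 0 <= t <= 1 -> p <> A s t) -> f p = p).

Definition lickorish_twists : set Mod := [set x | exists2 f : homeo,
  x = mapping_class f &
  [\/ exists j, is_dehn_twist (alpha_annulus j) f,
      exists j, is_dehn_twist (beta_annulus j) f |
      exists k l : 'I_g, l = k.+1 :> nat /\
        is_dehn_twist (gamma_annulus k l) f]].

End Surface.

Arguments lickorish_twists : clear implicits.

Section Cyclotomic.
Variables (R : realType) (r : nat).

Definition zetaC : R[i] := Complex (cos (2 * pi / r%:R)) (sin (2 * pi / r%:R)).

(* The smallest subfield of the complex numbers containing zeta. *)
Definition in_Qzeta : pred R[i] := fun x =>
  `[< forall S : {pred R[i]}, divring_closed S -> zetaC \in S -> x \in S >].

Lemma in_Qzeta_divring : divring_closed in_Qzeta.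
Proof.
split.
- by apply/asboolP => S cS _; have [] := cS.
- move=> x y /asboolP Sx /asboolP Sy; apply/asboolP => S cS zS.
  by have [_ sub _] := cS; apply: sub; [exact: Sx|exact: Sy].
- move=> x y /asboolP Sx /asboolP Sy; apply/asboolP => S cS zS.
  by have [_ _ dvd] := cS; apply: dvd; [exact: Sx|exact: Sy].
Qed.

HB.instance Definition _ :=
  GRing.isDivringClosed.Build R[i] in_Qzeta in_Qzeta_divring.

Record Qzeta := MkQzeta { Qzeta_val :> R[i]; _ : in_Qzeta Qzeta_val }.

HB.instance Definition _ := [isSub for Qzeta_val].
HB.instance Definition _ := [Choice of Qzeta by <:].
HB.instance Definition _ := [SubChoice_isSubIntegralDomain of Qzeta by <:].
HB.instance Definition _ := [SubIntegralDomain_isSubField of Qzeta by <:].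

Lemma zetaC_in : in_Qzeta zetaC.
Proof. by apply/asboolP. Qed.

Definition zeta : Qzeta := MkQzeta zetaC_in.

End Cyclotomic.

Section LinearGroups.
Variables (K : fieldType) (V : vectType K).

Record GL := MkGL { GL_val :> 'End(V); _ : lker GL_val == 0%VS }.

HB.instance Definition _ := [isSub for GL_val].
HB.instance Definition _ := [Choice of GL by <:].

Lemma GL_lker (h : GL) : lker h == 0%VS. Proof. exact: (valP h). Qed.

Lemma GL_one_subproof : lker (\1%VF : 'End(V)) == 0%VS.
Proof. by apply/lker0P => x y; rewrite !lfunE. Qed.

Lemma GL_mul_subproof (h k : GL) : lker (h \o k)%VF == 0%VS.
Proof.
apply/lker0P => x y; rewrite !lfunE /=.
by move=> /(lker0P (GL_lker h))/(lker0P (GL_lker k)).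
Qed.

Lemma GL_inv_subproof (h : GL) : lker (h^-1)%VF == 0%VS.
Proof.
by apply/lker0P; apply: can_inj (h : V -> V) _ => x; exact: lker0_lfunVK (GL_lker h) x.
Qed.

Definition GL_one := MkGL GL_one_subproof.
Definition GL_mul (h k : GL) := MkGL (GL_mul_subproof h k).
Definition GL_inv (h : GL) := MkGL (GL_inv_subproof h).

Lemma GL_mulA : associative GL_mul.
Proof. by move=> h k l; apply: val_inj; rewrite /= comp_lfunA. Qed.

Lemma GL_mul1 : left_id GL_one GL_mul.
Proof. by move=> h; apply: val_inj; rewrite /= comp_lfun1l. Qed.

Lemma GL_1mul : right_id GL_one GL_mul.
Proof. by move=> h; apply: val_inj; rewrite /= comp_lfun1r. Qed.

Lemma GL_mulV : left_inverse GL_one GL_inv GL_mul.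
Proof. by move=> h; apply: val_inj; rewrite /= lker0_compVf ?GL_lker. Qed.

Lemma GL_Vmul : right_inverse GL_one GL_inv GL_mul.
Proof. by move=> h; apply: val_inj; rewrite /= lker0_compfV ?GL_lker. Qed.

HB.instance Definition _ := isGroup.Build GL GL_mulA GL_mul1 GL_1mul GL_mulV GL_Vmul.

Definition proportional (h k : GL) : Prop :=
  exists2 c : K, c != 0 & forall v, h v = c *: k v.

Definition pgl_pregroup : pregroup.
Proof.
exists GL proportional GL_one GL_mul GL_inv.
- by move=> h; exists 1 => [|v]; rewrite ?oner_neq0 ?scale1r.
- move=> h k [c c0 hk]; exists c^-1; first by rewrite invr_eq0.
  by move=> v; rewrite hk scalerA mulVf// scale1r.
- move=> h k l [c c0 hk] [d d0 kl]; exists (c * d); first by rewrite mulf_neq0.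
  by move=> v; rewrite hk kl scalerA.
- move=> h h' k k' [c c0 hh] [d d0 kk]; exists (d * c).
    by rewrite mulf_neq0.
  by move=> v; rewrite /= !lfunE /= hh kk linearZ scalerA mulrC.
- move=> h k [c c0 hk]; exists c^-1; first by rewrite invr_eq0.
  move=> v /=; apply: (lker0P (GL_lker h)).
  rewrite (lker0_lfunVK (GL_lker h)) linearZ /= hk (lker0_lfunVK (GL_lker k)).
  by rewrite scalerA mulVf// scale1r.
- by move=> h k l; exists 1 => [|v]; rewrite ?oner_neq0 ?scale1r ?GL_mulA.
- by move=> h; exists 1 => [|v]; rewrite ?oner_neq0 ?scale1r ?GL_mul1.
- by move=> h; exists 1 => [|v]; rewrite ?oner_neq0 ?scale1r ?GL_1mul.
- by move=> h; exists 1 => [|v]; rewrite ?oner_neq0 ?scale1r ?GL_mulV.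
- by move=> h; exists 1 => [|v]; rewrite ?oner_neq0 ?scale1r ?GL_Vmul.
Defined.

Definition PGL : groupType := quot_group pgl_pregroup.

Definition to_PGL (h : GL) : PGL := @pg_class pgl_pregroup h.

End LinearGroups.

Section QuantumBinomial.
Variables (K : fieldType) (q : K).

Definition qint (n : nat) : K := (q ^+ n - q ^- n) / (q - q^-1).
Definition qfact (k : nat) : K := \prod_(1 <= j < k.+1) qint j.

(* Used for q of odd order r and n < r, where [n]_q! is nonzero. *)
Definition qbinom (n k : nat) : K := qfact n / (qfact k * qfact (n - k)).

End QuantumBinomial.

Section Schroedinger.
(* z is meant to be a primitive root of unity of order r > 1. *)
Variables (K : fieldType) (g r : nat) (z : K).

(* Well defined on Z/r since z ^+ r = 1. *)
Definition zpow (e : 'Z_r) : K := z ^+ (e : nat).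

Definition V1 : vectType K := {ffun 'Z_r -> K^o}.
Definition idx := {ffun 'I_g -> 'Z_r}.
Definition Vg : vectType K := {ffun idx -> K^o}.

Definition e1 (n : 'Z_r) : V1 := [ffun m => (m == n)%:R].

(* V_1^{(x) g} is identified with the functions on (Z/r)^g; the pure tensor of
   the basis vectors v_{n_1}, ..., v_{n_g} is the indicator of (n_1, ..., n_g). *)
Definition tensor (u : 'I_g -> V1) : Vg := [ffun m : idx => \prod_j u j (m j)].

Definition eg (n : idx) : Vg := tensor (fun j => e1 (n j)).

Definition set_index (n : idx) (j : 'I_g) (m : 'Z_r) : idx :=
  [ffun i => if i == j then m else n i].

Definition basis_image (h : GL Vg) (w : idx -> Vg) : Prop :=
  forall n, h (eg n) = w n.

Definition sigma_image (n : idx) : Vg := (- z ^- 2) *: eg n.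
Definition alpha_image (j : 'I_g) (n : idx) : Vg := zpow (4 * n j) *: eg n.
Definition beta_image (j : 'I_g) (n : idx) : Vg := eg (set_index n j (n j + 1)).

Definition G1 : K := \sum_(l < r) z ^ (- 2 * l%:Z * (l%:Z - 1)).

Definition tau_alpha_image (j : 'I_g) (n : idx) : Vg :=
  zpow (2 * (n j + 1) * n j) *: eg n.

Definition tau_beta_image (j : 'I_g) (n : idx) : Vg :=
  G1^-1 *: \sum_(m : 'Z_r)
    zpow (- (2 * (m - n j + 1) * (m - n j))) *: eg (set_index n j m).

Definition tau_gamma_image (k l : 'I_g) (n : idx) : Vg :=
  zpow (2 * (n k - n l + 1) * (n k - n l)) *: eg n.

Definition heis_action (phi : {multiplicative Heis g -> GL Vg}) : Prop :=
  [/\ basis_image (phi (hsigma g)) sigma_image,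
      forall j, basis_image (phi (halpha j)) (alpha_image j) &
      forall j, basis_image (phi (hbeta j)) (beta_image j)].

Definition class_image (x : PGL Vg) (w : idx -> Vg) : Prop :=
  exists2 h : GL Vg, x = to_PGL h & basis_image h w.

Definition mod_action (R : realType)
    (psi : {multiplicative Mod R g -> PGL Vg}) : Prop :=
  [/\ forall (j : 'I_g) (f : homeo R g), is_dehn_twist (alpha_annulus j) f ->
        class_image (psi (mapping_class f)) (tau_alpha_image j),
      forall (j : 'I_g) (f : homeo R g), is_dehn_twist (beta_annulus j) f ->
        class_image (psi (mapping_class f)) (tau_beta_image j) &
      forall (k l : 'I_g) (f : homeo R g), l = k.+1 :> nat ->
        is_dehn_twist (gamma_annulus k l) f ->
        class_image (psi (mapping_class f)) (tau_gamma_image k l)].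

Definition t_vec (n : nat) : V1 :=
  \sum_(k < n.+1)
    ((-1) ^+ (n - k) * z ^ ((n%:Z - k%:Z) * (n%:Z - 1)) * qbinom z n k)
      *: e1 (k : nat)%:R.

Definition v'_vec (n : {ffun 'I_g -> 'I_r}) : Vg :=
  (1 - z) ^- (\sum_j n j)./2 *: tensor (fun j => t_vec (n j)).

Definition in_Zz (x : K) : Prop :=
  exists p : {poly int}, x = (map_poly intr p).[z].

Definition lattice' : set Vg := [set v |
  exists2 c : {ffun 'I_g -> 'I_r} -> K, (forall n, in_Zz (c n)) &
    v = \sum_n c n *: v'_vec n].

End Schroedinger.

Arguments lattice' {K} g r z.

(* Main.v *)
(* Write x_j for the shift v_n |-> v_(n+1) of the j-th factor and w = 1 - z.
   By the q-binomial theorem t_n = prod_(i<n) (x - z^(2i)) . v_0, and t_r = 0.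
   Give w weight 2 and x_j - 1 weight 1: the lattice is the weight >= 0 part of
   the resulting filtration, whose weight >= s part is spanned by the
   w^a t_n with 2a + |n| >= s.  Call F raising if F - 1 raises weights by 1; the
   shifts are raising, and so are the diagonal operators multiplying e_n by
   q^(d(n)), q = z^4, for linear forms d.

   The function q^k |-> q^(k choose 2) on r-th roots of unity is interpolated at
   the nodes 1, q, q^2, ... by a polynomial f whose m-th Newton coefficient is 0
   for m odd and lies in w^(-m/2) Z[z] for m even, as the factors q^i - 1 of its
   denominator are associate to w when r is prime.  Hence f(F) preserves the
   lattice for every raising F of order r.  The three families of twists are
   D f(D), f(x_j) and D' f(D') for diagonal operators D and D', and all the
   generators have finite order on the lattice, so they map it onto itself. *)

Require Import Defs.
From HB Require Import structures.
From mathcomp Require Import all_boot all_order all_algebra.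
From mathcomp Require Import complex.
From mathcomp Require Import all_classical all_reals all_analysis.
From mathcomp Require Import zify ring.

Import Order.TTheory GRing.Theory Num.Theory.

Local Open Scope classical_set_scope.
Local Open Scope ring_scope.

Set Implicit Arguments.
Unset Strict Implicit.
Unset Printing Implicit Defensive.

(** * The (1 - z)-adic weight of scalars *)

Section Weights.
Variables (K : fieldType) (z : K).

Lemma in_Zz_int (m : int) : in_Zz z m%:~R.
Proof. by exists m%:P; rewrite map_polyC hornerC. Qed.

Lemma in_Zz_gen : in_Zz z z.
Proof. by exists 'X; rewrite map_polyX hornerX. Qed.

Lemma in_ZzD x y : in_Zz z x -> in_Zz z y -> in_Zz z (x + y).
Proof. by move=> [p ->] [q ->]; exists (p + q); rewrite rmorphD hornerD. Qed.

Lemma in_ZzM x y : in_Zz z x -> in_Zz z y -> in_Zz z (x * y).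
Proof. by move=> [p ->] [q ->]; exists (p * q); rewrite rmorphM hornerM. Qed.

Lemma in_ZzN x : in_Zz z x -> in_Zz z (- x).
Proof. by move=> [p ->]; exists (- p); rewrite rmorphN hornerN. Qed.

Lemma in_Zz1 : in_Zz z 1. Proof. exact: (in_Zz_int 1). Qed.

Lemma in_Zz0 : in_Zz z 0. Proof. exact: (in_Zz_int 0). Qed.

Lemma in_ZzX x n : in_Zz z x -> in_Zz z (x ^+ n).
Proof.
move=> Ox; elim: n => [|n IHn]; first exact: in_Zz1.
by rewrite exprS; exact: in_ZzM.
Qed.

Lemma in_Zz_sum I (s : seq I) (P : pred I) (F : I -> K) :
  (forall i, P i -> in_Zz z (F i)) -> in_Zz z (\sum_(i <- s | P i) F i).
Proof. by move=> OF; apply: big_ind => //; [exact: in_Zz0|exact: in_ZzD]. Qed.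

(* [x] lies in the ideal generated by [(1 - z)^(s/2)], rounded up. *)
Definition wt (s : int) (x : K) : Prop :=
  exists2 a : int, s <= a *+ 2 & exists2 o, in_Zz z o & x = (1 - z) ^ a * o.

Hypothesis z_neq1 : 1 - z != 0.

Lemma wt_le s t x : s <= t -> wt t x -> wt s x.
Proof. by move=> st [a ta xE]; exists a => //; exact: le_trans ta. Qed.

Lemma wt_in_Zz x : in_Zz z x -> wt 0 x.
Proof. by move=> Ox; exists 0 => //; exists x; rewrite ?expr0z ?mul1r. Qed.

Lemma wt0 s : wt s 0.
Proof.
exists `|s|%N; first by lia.
by exists 0; [exact: in_Zz0|rewrite mulr0].
Qed.

Lemma wtD s x y : wt s x -> wt s y -> wt s (x + y).
Proof.
(* The smaller power of 1 - z is factored out; the power left over has exponent b - a >= 0, so it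
   lies in Z[z]. *)
have aux a b o o' : a <= b -> s <= a *+ 2 -> in_Zz z o -> in_Zz z o' ->
    wt s ((1 - z) ^ a * o + (1 - z) ^ b * o').
  move=> ab sa Oo Oo'; exists a => //; exists (o + (1 - z) ^+ `|b - a|%N * o').
    apply: in_ZzD => //; apply: in_ZzM => //; apply: in_ZzX.
    by apply: in_ZzD; [exact: in_Zz1|apply: in_ZzN; exact: in_Zz_gen].
  have -> : (1 - z) ^ b = (1 - z) ^ a * (1 - z) ^+ `|b - a|%N.
    by rewrite exprnP -expfzDr//; congr (_ ^ _); lia.
  by rewrite mulrDr mulrA.
move=> [a sa [u Ou ->] ] [b sb [w Ow ->] ].
have [ab|/ltW ba] := leP a b; first exact: aux.
by rewrite addrC; exact: aux.
Qed.

Lemma wtN s x : wt s x -> wt s (- x).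
Proof.
move=> [a sa [u Ou ->]]; exists a => //.
by exists (- u); [exact: in_ZzN|rewrite mulrN].
Qed.

Lemma wtM s t x y : wt s x -> wt t y -> wt (s + t) (x * y).
Proof.
move=> [a sa [u Ou ->] ] [b tb [w Ow ->] ]; exists (a + b).
  by rewrite mulrnDl lerD.
by exists (u * w); [exact: in_ZzM|rewrite expfzDr// mulrACA].
Qed.

Lemma wt_exp n : wt 0 (z ^+ n).
Proof. by apply: wt_in_Zz; apply: in_ZzX; exact: in_Zz_gen. Qed.

(** The quotient by 1 - z is a geometric sum in Z[z]. *)
Lemma wt_sub1X n : wt 2 (1 - z ^+ n).
Proof.
exists 1 => //; rewrite expr1z; exists (\sum_(i < n) z ^+ i).
  by apply: in_Zz_sum => i _; apply: in_ZzX; exact: in_Zz_gen.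
by rewrite -opprB subrX1 -mulNr opprB.
Qed.

Variable r : nat.
Hypothesis z_prim : r.-primitive_root z.

(* [z] is a power of [z^n], so [1 - z^n] divides [1 - z] in Z[z]. *)
Lemma wt_inv_sub1X n : coprime n r -> wt (- 2) ((1 - z ^+ n)^-1).
Proof.
move=> co; exists (-1) => //.
have r0 := prim_order_gt0 z_prim.
(* For r = 1 the root z would be 1. Once r > 1, coprimality forces n > 0, as the Bezout argument
   below requires. *)
have [r1|r1] := leqP r 1.
  have {}r1 : r = 1%N by lia.
  by move: (prim_expr_order z_prim) z_neq1; rewrite r1 expr1 => ->; rewrite subrr eqxx.
have n0 : (0 < n)%N by case: n co => //; rewrite /coprime gcd0n => /eqP; lia.
have [m mE] : exists m, (n * m = 1 %[mod r])%N.
  have [km kn e _] := egcdnP r n0; exists km.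
  by rewrite mulnC e (eqP co) modnMDl.
have {}mE : z ^+ (n * m) = z by rewrite -(prim_expr_mod z_prim) mE (prim_expr_mod z_prim) expr1.
have n_neq : 1 - z ^+ n != 0.
  by apply: contraNneq z_neq1 => /subr0_eq e; rewrite -{1}mE exprM -e expr1n subrr.
exists (\sum_(i < m) (z ^+ n) ^+ i).
  by apply: in_Zz_sum => i _; apply: in_ZzX; apply: in_ZzX; exact: in_Zz_gen.
have e : 1 - z = (1 - z ^+ n) * \sum_(i < m) (z ^+ n) ^+ i.
  by rewrite -{1}mE exprM -opprB subrX1 -mulNr opprB.
by apply: (mulfI n_neq); rewrite mulrCA -e divff// exprN1 mulVf.
Qed.

End Weights.

(** * Quantum integers and the action of the shift on the vectors t_n *)

Section ShiftNewton.
Variables (K : fieldType) (r : nat) (z : K).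
Hypotheses (r_odd : odd r) (r_gt1 : (1 < r)%N) (z_prim : r.-primitive_root z).

Lemma prim_root_neq0 : z != 0.
Proof.
apply: contra_eq_neq (prim_expr_order z_prim) => ->.
by rewrite expr0n gtn_eqF ?(prim_order_gt0 z_prim)// eq_sym oner_eq0.
Qed.

(** Otherwise z^(2n) = 1, and r, being odd, would divide n. This makes the quantum factorials [n]!,
    n < r, invertible. *)
Lemma expr_neq_inv n : (0 < n < r)%N -> z ^+ n - z ^- n != 0.
Proof.
move=> /andP[n0 nr]; apply: contraTneq nr => /subr0_eq e; rewrite -leqNgt.
have : z ^+ (2 * n) = 1.
  by rewrite mul2n -addnn exprD {1}e mulVf// expf_neq0// prim_root_neq0.
move/eqP; rewrite -(prim_order_dvd z_prim) Gauss_dvdr ?coprimen2//.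
exact: dvdn_leq.
Qed.

Lemma qint_neq0 n : (0 < n < r)%N -> qint z n != 0.
Proof.
move=> nr; rewrite mulf_neq0 ?invr_eq0 ?expr_neq_inv//.
by have := @expr_neq_inv 1; rewrite expr1; exact.
Qed.

Lemma qfactS n : qfact z n.+1 = qfact z n * qint z n.+1.
Proof. by rewrite /qfact big_nat_recr. Qed.

Lemma qfact_neq0 n : (n < r)%N -> qfact z n != 0.
Proof.
elim: n => [|n IHn] nr; first by rewrite /qfact big_nil oner_eq0.
by rewrite qfactS mulf_neq0 ?IHn ?qint_neq0// ltnW.
Qed.

Lemma qint_order : qint z r = 0.
Proof. by rewrite /qint (prim_expr_order z_prim) invr1 subrr mul0r. Qed.

(** The quantum Pascal rule, with the common factor of the binomials removed. *)
Lemma qint_add m n :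
  z ^+ n * qint z (m + n) = qint z m + z ^+ (m + n) * qint z n.
Proof.
rewrite /qint !mulrA -mulrDl; congr (_ / _).
rewrite exprD; have := expf_neq0 m prim_root_neq0.
have := expf_neq0 n prim_root_neq0.
by move: (z ^+ m) (z ^+ n) => a b b0 a0; field; rewrite b0.
Qed.

Lemma qbinom0 n : (n < r)%N -> qbinom z n 0 = 1.
Proof.
by move=> nr; rewrite /qbinom subn0 {2}/qfact big_nil mul1r divff ?qfact_neq0.
Qed.

Lemma qbinomnn n : (n < r)%N -> qbinom z n n = 1.
Proof.
by move=> nr; rewrite /qbinom subnn {3}/qfact big_nil mulr1 divff ?qfact_neq0.
Qed.

(** By the q-binomial theorem, the coefficient of x^i in the product of the x - z^(2j), j < k. *)
Definition t_coef (k i : nat) : K :=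
  (-1) ^+ (k - i) * z ^ ((k%:Z - i%:Z) * (k%:Z - 1)) * qbinom z k i.

(** Comparison of the coefficients of x^(i+1) in x t_k = t_(k+1) + z^(2k) t_k, with t_r read as 0.
    Up to the common factor [B * A] it is [qint_add]. *)
Lemma t_coef_rec k i : (i < k < r)%N ->
  t_coef k i = (if (k.+1 < r)%N then t_coef k.+1 i.+1 else 0)
               + z ^+ (2 * k) * t_coef k i.+1.
Proof.
move=> /andP[/subnKC]; move: (k - i.+1)%N => e ke kr.
have z0 := prim_root_neq0.
pose A := qfact z k / (qfact z i.+1 * qfact z e.+1).
pose B : K := (-1) ^+ e.+1 * z ^ (e.+1%:Z * (k%:Z - 1)).
have ei : (e.+1 < r)%N by lia.
have ii : (i.+1 < r)%N by lia.
have E1 : t_coef k i = B * (A * qint z i.+1).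
  rewrite /t_coef /qbinom /A /B -ke (_ : (_ - i)%N = e.+1); last by lia.
  rewrite (_ : _%:Z - i%:Z = e.+1); last by lia.
  rewrite (qfactS i); congr (_ * _); field.
  by rewrite !qfact_neq0 ?qint_neq0//; lia.
have E2 : z ^+ (2 * k) * t_coef k i.+1 = - (B * (A * (z ^+ k.+1 * qint z e.+1))).
  rewrite /t_coef /qbinom /A /B (_ : (k - i.+1)%N = e); last by lia.
  rewrite (_ : _%:Z - i.+1%:Z = e); last by lia.
  have -> : e.+1%:Z * (k%:Z - 1) = e%:Z * (k%:Z - 1) + k%:Z - 1 by lia.
  rewrite expfzDr// expfzDr// (qfactS e) mul2n -addnn exprD !exprS exprN1 -exprnP.
  by field; rewrite z0 !qfact_neq0 ?qint_neq0//; lia.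
have E3 : (if (k.+1 < r)%N then t_coef k.+1 i.+1 else 0) =
          B * (A * (z ^+ e.+1 * qint z k.+1)).
  (* In the truncated case k + 1 = r the formula survives because [r] = 0. *)
  case: ltnP => [k1r|rk]; last first.
    by rewrite (_ : k.+1 = r) ?qint_order ?mulr0//; lia.
  rewrite /t_coef /qbinom /A /B (_ : (k.+1 - i.+1)%N = e.+1); last by lia.
  have -> : (k.+1%:Z - i.+1%:Z) * (k.+1%:Z - 1) = e.+1%:Z * (k%:Z - 1) + e.+1%:Z by lia.
  rewrite expfzDr// (qfactS k) -[z ^ e.+1%:Z]exprnP.
  by field; rewrite !qfact_neq0//; lia.
rewrite E1 E2 E3 -!mulrBr; congr (_ * (_ * _)).
have := qint_add i.+1 e.+1; rewrite (_ : (i.+1 + e.+1)%N = k.+1); last by lia.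
by move=> ->; rewrite addrK.
Qed.

Lemma t_coefnn n : (n < r)%N -> t_coef n n = 1.
Proof.
by move=> nr; rewrite /t_coef subnn subrr mul0r qbinomnn ?expr0z ?mul1r.
Qed.

Lemma t_vecE k (m : 'Z_r) : (k < r)%N ->
  t_vec r z k m = if (m <= k)%N then t_coef k m else 0.
Proof.
move=> kr; rewrite /t_vec sum_ffunE.
under eq_bigr => i _.
  rewrite !ffunE -val_eqE /= val_Zp_nat// modn_small; last first.
    by rewrite (leq_trans (ltn_ord i)).
  over.
have [mk|mk] := leqP m k.
  rewrite (bigD1 (Ordinal (mk : (m < k.+1)%N)))//= eqxx -[RHS]addr0; congr (_ + _).
    exact: mulr1.
  rewrite big1// => i; rewrite -val_eqE /= => /negPf im.
  by rewrite eq_sym im; exact: mulr0.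
rewrite big1// => i _; rewrite gtn_eqF ?mulr0//; first exact: mulr0.
by rewrite (leq_trans (ltn_ord i)).
Qed.

(* Multiplication by [x] when [v_k] stands for [x^k] in K[x]/(x^r - 1);
   then [t_k] is the product of the [x - z^(2i)], [i < k]. *)
Definition shift1 (u : V1 K r) : V1 K r := [ffun m => u (m - 1)].

Let val_natr n : (n < r)%N -> (n%:R : 'Z_r) = n :> nat.
Proof. by move=> nr; rewrite val_Zp_nat// modn_small. Qed.

(** One more factor x - z^(2k) turns t_k into t_(k+1), and after r factors the product is x^r - 1 =
    0. Coordinates are compared, index 0 apart because the shift wraps around there. *)
Let shift1_t_vecE k : (k < r)%N ->
  shift1 (t_vec r z k) =
    z ^+ (2 * k) *: t_vec r z k + (if (k.+1 < r)%N then t_vec r z k.+1 else 0).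
Proof.
move=> kr; apply/ffunP => m.
rewrite [LHS]ffunE [RHS]ffunE [X in _ = X + _]ffunE -[m in RHS]natr_Zp -[m in LHS]natr_Zp.
have : (m < r)%N by have := ltn_ord m; rewrite [X in (_ < X)%N]Zp_cast.
case: (m : nat) => [|i] ir.
- have -> : 0%:R - 1 = (r.-1)%:R :> 'Z_r.
    by rewrite -subn1 natrB ?pchar_Zp// ltnW.
  rewrite !t_vecE// !val_natr//; last by lia.
  have t0 n : (n < r)%N -> t_coef n 0 = (-1) ^+ n * z ^ (n%:Z * (n%:Z - 1)).
    by move=> nr; rewrite /t_coef qbinom0// mulr1 subn0 subr0.
  have tS : z ^+ (2 * k) * t_coef k 0 = (-1) ^+ k * z ^ (k.+1%:Z * (k.+1%:Z - 1)).
    rewrite t0// mulrCA [z ^+ _]exprnP -expfzDr ?prim_root_neq0//; congr (_ * _ ^ _); lia.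
  rewrite leq0n. rewrite [X in _ = X + _]tS.
  have [k1r|rk] := ltnP k.+1 r.
    rewrite ifF ?t_vecE// ?val_natr// ?t0//; last by lia.
    by rewrite exprS mulN1r mulNr subrr.
  (* The top coordinate 1 of t_(r-1) wraps to index 0. It matches z^(2k) times the constant
     coefficient, because that product is (-1)^(r-1) z^(r(r-1)) = 1, r being odd. *)
  have -> : k = r.-1 by lia.
  rewrite leqnn prednK ?(ltnW r_gt1)// ffunE addr0 t_coefnn; last by lia.
  rewrite -exprz_exp -exprnP (prim_expr_order z_prim) exp1rz mulr1 -signr_odd.
  by rewrite (_ : odd r.-1 = false) ?expr0//; lia.
- have -> : i.+1%:R - 1 = i%:R :> 'Z_r by rewrite -natr1 addrK.
  rewrite !t_vecE// !val_natr//; last by lia.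
  have -> : (if (k.+1 < r)%N then t_vec r z k.+1 else 0) i.+1%:R =
    if (i <= k)%N then if (k.+1 < r)%N then t_coef k.+1 i.+1 else 0 else 0.
    case: ltnP => k1r; last by rewrite ffunE if_same.
    by rewrite t_vecE// val_natr.
  have [ik|ki] := ltnP i k.
    by rewrite (ltnW ik) t_coef_rec ?ik// addrC.
  case: (leqP i k) => ik; last by rewrite scaler0 addr0.
  have ki' : k = i by lia.
  by rewrite scaler0 add0r ki' ir !t_coefnn// -ki'.
Qed.

Lemma shift1_t_vec k : (k.+1 < r)%N ->
  shift1 (t_vec r z k) = z ^+ (2 * k) *: t_vec r z k + t_vec r z k.+1.
Proof. by move=> kr; rewrite shift1_t_vecE ?kr// ltnW. Qed.

Lemma shift1_t_vec_last k : k.+1 = r ->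
  shift1 (t_vec r z k) = z ^+ (2 * k) *: t_vec r z k.
Proof. by move=> kr; rewrite shift1_t_vecE -?kr// ltnn addr0. Qed.

End ShiftNewton.

(** * The filtration of V_g by weight and the operators raising it *)

Section Filtration.
Variables (K : fieldType) (g r : nat) (z : K).
Hypotheses (r_odd : odd r) (r_gt1 : (1 < r)%N) (z_prim : r.-primitive_root z).

Local Notation V := (Vg K g r).

Lemma sub1_prim_root_neq0 : 1 - z != 0.
Proof.
rewrite subr_eq0 eq_sym -(expr0 z) -{1}(expr1 z) (eq_prim_root_expr z_prim).
by rewrite eqn_mod_dvd// dvdn1 gtn_eqF.
Qed.

Let z1 := sub1_prim_root_neq0.

(** Vectors are functions of the index, so v_n |-> v_(n+1) on the j-th factor becomes evaluation at
    n_j - 1. *)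
Definition vshift (j : 'I_g) (v : V) : V :=
  [ffun m => v (set_index m j (m j - 1))].

Lemma vshift_is_linear j : linear (vshift j).
Proof. by move=> c u v; apply/ffunP => m; rewrite !ffunE. Qed.

HB.instance Definition _ j :=
  GRing.isLinear.Build K V V _ (vshift j) (vshift_is_linear j).

Lemma vshift_tensor j (u : 'I_g -> V1 K r) :
  vshift j (tensor u) = tensor (fun i => if i == j then shift1 (u i) else u i).
Proof.
apply/ffunP => m; rewrite !ffunE; apply: eq_bigr => i _; rewrite ffunE.
by case: eqP => // ->; rewrite ffunE.
Qed.

Lemma tensor_linear_at j (u u' w : 'I_g -> V1 K r) (c : K) :
  (forall i, i != j -> u i = w i) -> (forall i, i != j -> u' i = w i) ->
  w j = c *: u j + u' j -> tensor w = c *: tensor u + tensor u'.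
Proof.
move=> uw u'w wj; apply/ffunP => m; rewrite !ffunE.
rewrite [LHS](bigD1 j)// [X in _ = c *: X + _](bigD1 j)//.
rewrite [X in _ = _ + X](bigD1 j)//= wj !ffunE.
rewrite [in RHS](eq_bigr (fun i => w i (m i))); last by move=> i /uw ->.
rewrite [X in _ = _ + _ * X](eq_bigr (fun i => w i (m i))); last by move=> i /u'w ->.
by rewrite mulrDl -mulrA.
Qed.

Definition t_tensor (n : {ffun 'I_g -> 'I_r}) : V :=
  tensor (fun j => t_vec r z (n j)).

Lemma vshift_t_tensor j (n n' : {ffun 'I_g -> 'I_r}) :
  n' j = (n j).+1 :> nat -> (forall i, i != j -> n' i = n i) ->
  vshift j (t_tensor n) = z ^+ (2 * n j) *: t_tensor n + t_tensor n'.
Proof.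
move=> n'j n'i; rewrite vshift_tensor; apply: (@tensor_linear_at j).
- by move=> i /= /negPf ->.
- by move=> i ij; rewrite /= (negPf ij) n'i.
- by rewrite /= eqxx (shift1_t_vec r_odd r_gt1 z_prim) -n'j.
Qed.

Lemma vshift_t_tensor_last j (n : {ffun 'I_g -> 'I_r}) : (n j).+1 = r ->
  vshift j (t_tensor n) = z ^+ (2 * n j) *: t_tensor n.
Proof.
move=> nj; rewrite vshift_tensor -[RHS]addr0.
(* A zero summand, written as a tensor with j-th factor 0, brings the goal into the shape of
   [tensor_linear_at]. *)
rewrite -[X in _ + X](_ : tensor (fun i => if i == j then 0 else t_vec r z (n i)) = 0).
  apply: (@tensor_linear_at j).
  - by move=> i /= /negPf ->.
  - by move=> i /= /negPf ->.
  - by rewrite /= eqxx (shift1_t_vec_last r_odd r_gt1 z_prim)// addr0.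
by apply/ffunP => m; rewrite !ffunE (bigD1 j)//= eqxx ffunE mul0r.
Qed.

Definition degree (n : {ffun 'I_g -> 'I_r}) : nat := (\sum_j n j)%N.

(** The degrees are compared by sums to avoid truncated subtraction, as k may lie on either side of
    n_j. *)
Lemma set_exponent (n : {ffun 'I_g -> 'I_r}) j k : (k < r)%N ->
  exists n' : {ffun 'I_g -> 'I_r}, [/\ n' j = k :> nat,
    forall i, i != j -> n' i = n i & (degree n' + n j = degree n + k)%N].
Proof.
move=> kr; exists [ffun i => if i == j then Ordinal kr else n i]; split.
- by rewrite ffunE eqxx.
- by move=> i /negPf; rewrite ffunE => ->.
rewrite /degree (bigD1 j)//= [in RHS](bigD1 j)//= ffunE eqxx /=.
rewrite (eq_bigr (fun i => n i : nat)) => [|i /negPf]; last by rewrite ffunE => ->.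
by rewrite addnC (addnC k) addnA.
Qed.

(* With [1 - z] of weight 2 and [X_j - 1] of weight 1, these are the vectors
   of weight at least [s]; [lattice'] is the case [s = 0]. *)
Definition filtration (s : int) (v : V) : Prop :=
  exists2 c : {ffun 'I_g -> 'I_r} -> K,
    (forall n, wt z (s - (degree n)%:Z) (c n)) &
    v = \sum_n c n *: t_tensor n.

Lemma filtration0 s : filtration s 0.
Proof.
exists (fun=> 0) => [n|]; first exact: wt0.
by rewrite big1// => n _; rewrite scale0r.
Qed.

Lemma filtrationD s u v : filtration s u -> filtration s v -> filtration s (u + v).
Proof.
move=> [c wc ->] [d wd ->]; exists (fun n => c n + d n).
  by move=> n; exact: wtD.
by rewrite -big_split; apply: eq_bigr => n _; rewrite scalerDl.
Qed.

Lemma filtrationZ s t c v : wt z s c -> filtration t v -> filtration (s + t) (c *: v).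
Proof.
move=> wc [d wd ->]; exists (fun n => c * d n).
  by move=> n; rewrite -addrA; exact: wtM.
by rewrite scaler_sumr; apply: eq_bigr => n _; rewrite scalerA.
Qed.

Lemma filtration_le s t v : s <= t -> filtration t v -> filtration s v.
Proof.
move=> st [c wc ->]; exists c => // n.
by apply: wt_le (wc n); rewrite lerD2r.
Qed.

Lemma filtrationN s v : filtration s v -> filtration s (- v).
Proof.
move=> Mv; rewrite -scaleN1r -[s]add0r; apply: filtrationZ => //.
by apply: wt_in_Zz; apply: in_ZzN; exact: in_Zz1.
Qed.

Lemma filtration_sum I (q : seq I) (P : pred I) (F : I -> V) s :
  (forall i, P i -> filtration s (F i)) -> filtration s (\sum_(i <- q | P i) F i).
Proof. by move=> MF; apply: big_ind => //; [exact: filtration0|exact: filtrationD]. Qed.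

Lemma filtration_t_tensor n : filtration (degree n)%:Z (t_tensor n).
Proof.
exists (fun m => (m == n)%:R) => [m|].
  have [->|_] := eqVneq m n; last exact: wt0.
  by rewrite subrr; apply: wt_in_Zz; exact: in_Zz1.
rewrite (bigD1 n)//= eqxx scale1r big1 ?addr0// => m /negPf ->.
by rewrite scale0r.
Qed.

(** The coefficient of t_n has weight s - |n|, so a gain of k on every t_n, itself of weight |n|,
    becomes a gain of k on the whole filtration. *)
Lemma filtration_ind k (F : {linear V -> V}) :
  (forall n, filtration ((degree n)%:Z + k) (F (t_tensor n))) ->
  forall s v, filtration s v -> filtration (s + k) (F v).
Proof.
move=> MF s v [c wc ->]; rewrite linear_sum; apply: filtration_sum => n _.
rewrite linearZ /=; have := filtrationZ (wc n) (MF n).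
by rewrite addrA subrK.
Qed.

Definition raises (F : V -> V) : Prop :=
  forall s v, filtration s v -> filtration (s + 1) (F v - v).

Lemma raises_ind (F : {linear V -> V}) :
  (forall n, filtration ((degree n)%:Z + 1) (F (t_tensor n) - t_tensor n)) ->
  raises F.
Proof. exact: (@filtration_ind 1 (F \- idfun)). Qed.

Lemma raises_filtration (F : V -> V) s v : raises F -> filtration s v -> filtration s (F v).
Proof.
move=> rF Mv; rewrite -[F v](subrK v); apply: filtrationD => //.
by apply: filtration_le (rF s v Mv); rewrite lerDl.
Qed.

Lemma filtration_sub1X s v n : filtration s v -> filtration (s + 1) ((1 - z ^+ n) *: v).
Proof.
move=> Mv; apply: (@filtration_le _ (2 + s)); first by rewrite addrC lerD2r.
by apply: filtrationZ => //; exact: wt_sub1X.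
Qed.

(** F - z^n is F - 1 plus the scalar 1 - z^n of weight 2. Taken at powers of q, this governs the
    factors of the Newton polynomials. *)
Lemma raises_sub (F : V -> V) n s v : raises F -> filtration s v ->
  filtration (s + 1) (F v - z ^+ n *: v).
Proof.
move=> rF Mv; have -> : F v - z ^+ n *: v = (F v - v) + (1 - z ^+ n) *: v.
  by rewrite scalerBl scale1r addrA subrK.
by apply: filtrationD; [exact: rF|exact: filtration_sub1X].
Qed.

Lemma raises_vshift j : raises (vshift j).
Proof.
apply: raises_ind => n /=; have Mn := filtration_t_tensor n.
have [nr|nr] := ltnP (n j).+1 r; last first.
  rewrite vshift_t_tensor_last; last by have := ltn_ord (n j); lia.
  rewrite -[X in _ - X]scale1r -scalerBl -opprB scaleNr.
  by apply: filtrationN; exact: filtration_sub1X.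
have [n' [n'j n'i dn']] := set_exponent n j nr.
(* Here x_j t_n - t_n is t_n' plus z^(2 n_j) - 1 times t_n: the first gains 1 in degree, the second
   2 in weight. *)
rewrite (vshift_t_tensor n'j n'i) addrAC; apply: filtrationD.
  rewrite -[X in _ - X]scale1r -scalerBl -opprB scaleNr.
  by apply: filtrationN; exact: filtration_sub1X.
rewrite (_ : _ + 1 = (degree n')%:Z); first exact: filtration_t_tensor.
by lia.
Qed.

(** Induction on the degree: t_n = (x_j - z^(2k)) t_n', where n' has j-th exponent k = n_j - 1. The
    commutation rule moves F past x_j and expresses F t_n - t_n through t_n' and w = F t_n' -
    t_n'. *)
Lemma raises_diagonal (F : {linear V -> V}) :
  (forall n, degree n = 0%N -> F (t_tensor n) = t_tensor n) ->
  (forall j, exists e : nat, forall v, F (vshift j v) = z ^+ e *: vshift j (F v)) ->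
  raises F.
Proof.
move=> F0 Fshift; apply: raises_ind => n.
have [d] := ubnP (degree n); elim: d n => // d IHd n nd.
have [n0|n_gt0] := posnP (degree n); first by rewrite F0// subrr; exact: filtration0.
have [j nj] : exists j, (0 < n j)%N.
  apply/existsP; apply: contraLR n_gt0; rewrite negb_exists => /forallP n0.
  by rewrite -leqNgt leqn0 sum_nat_eq0; apply/forallP => i /=; rewrite -leqn0 leqNgt n0.
have [e Fshift_j] := Fshift j.
have [|n' [n'j n'i dn']] := @set_exponent n j (n j).-1.
  by rewrite (leq_ltn_trans (leq_pred _)).
have := IHd n'; set w := F _ - _ => Mw.
have {}Mw : filtration ((degree n')%:Z + 1) w by apply: Mw; lia.
have Mu := filtration_t_tensor n'; set u := t_tensor n' in w Mw Mu.
have tE : t_tensor n = vshift j u - z ^+ (2 * n' j) *: u.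
  rewrite (@vshift_t_tensor j n' n) => [||i /n'i//]; last by rewrite n'j prednK.
  by rewrite addrC addKr.
have Fu : F u = w + u by rewrite subrK.
clearbody w u.
have -> : (degree n)%:Z = (degree n')%:Z + 1 by lia.
(* The terms are grouped so that w, already one unit above |n'|, is always hit by x_j - 1 or by some
   1 - z^i and gains another unit. *)
have -> : F (t_tensor n) - t_tensor n = z ^+ e *: (vshift j w - w) -
    (1 - z ^+ e) *: w + (1 - z ^+ (2 * n' j)) *: w - (1 - z ^+ e) *: vshift j u.
  rewrite tE linearB linearZ Fshift_j Fu linearD /= !scalerBl !scale1r.
  rewrite scalerBr !scalerDr.
  set a1 := _ *: vshift j u; set a2 := _ *: vshift j w; set a3 := _ *: w.
  set a4 := _ *: u; set a5 := _ *: w.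
  by apply/ffunP => m; rewrite !ffunE; ring.
have rs := raises_vshift j.
(* Since u has only weight |n'|, the full weight 2 of 1 - z^e has to supply both missing units. *)
have Msu : filtration ((degree n')%:Z + 1 + 1) ((1 - z ^+ e) *: vshift j u).
  apply: (@filtration_le _ (2 + (degree n')%:Z)); first by lia.
  apply: filtrationZ; [exact: wt_sub1X|exact: raises_filtration].
apply: filtrationD; last exact: filtrationN.
apply: filtrationD; last exact: filtration_sub1X.
apply: filtrationD; last by apply: filtrationN; exact: filtration_sub1X.
by rewrite -[_ + 1]add0r; apply: filtrationZ; [exact: wt_exp|exact: rs].
Qed.

End Filtration.

(** * Evaluation of polynomials at a linear endomorphism *)

Section PolyAction.
Variables (K : fieldType) (V : lmodType K) (F : {linear V -> V}).

Lemma iter_is_linear i : linear (iter i F).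
Proof. by elim: i => [|i IHi] c u v //=; rewrite IHi linearP. Qed.

HB.instance Definition _ i :=
  GRing.isLinear.Build K V V _ (iter i F) (iter_is_linear i).

Definition poly_act (p : {poly K}) (v : V) : V :=
  \sum_(i < size p) p`_i *: iter i F v.

Lemma poly_act_is_linear p : linear (poly_act p).
Proof.
move=> c u v; rewrite scaler_sumr -big_split; apply: eq_bigr => i _.
by rewrite linearP scalerDr !scalerA mulrC.
Qed.

HB.instance Definition _ p :=
  GRing.isLinear.Build K V V _ (poly_act p) (poly_act_is_linear p).

Lemma poly_act_widen n (p : {poly K}) v : (size p <= n)%N ->
  poly_act p v = \sum_(i < n) p`_i *: iter i F v.
Proof.
move=> pn; rewrite /poly_act (big_ord_widen n (fun i => p`_i *: iter i F v))//.
rewrite big_mkcond; apply: eq_bigr => i _; case: ltnP => // pi.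
by rewrite nth_default// scale0r.
Qed.

Lemma poly_actD p q v : poly_act (p + q) v = poly_act p v + poly_act q v.
Proof.
rewrite (poly_act_widen v (size_polyD p q)).
rewrite (@poly_act_widen (maxn (size p) (size q)) p) ?leq_maxl//.
rewrite (@poly_act_widen (maxn (size p) (size q)) q) ?leq_maxr// -big_split.
by apply: eq_bigr => i _; rewrite coefD scalerDl.
Qed.

Lemma poly_actZ c p v : poly_act (c *: p) v = c *: poly_act p v.
Proof.
rewrite (poly_act_widen v (size_scale_leq c p)) scaler_sumr.
by apply: eq_bigr => i _; rewrite coefZ scalerA.
Qed.

Lemma poly_actN p v : poly_act (- p) v = - poly_act p v.
Proof. by rewrite -[- p]scaleN1r poly_actZ scaleN1r. Qed.

Lemma poly_act0 v : poly_act 0 v = 0.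
Proof. by rewrite /poly_act size_poly0 big_ord0. Qed.

Lemma poly_act_sum I (s : seq I) (P : pred I) (G : I -> {poly K}) v :
  poly_act (\sum_(i <- s | P i) G i) v = \sum_(i <- s | P i) poly_act (G i) v.
Proof.
apply: (big_morph (poly_act^~ v)); last exact: poly_act0.
by move=> p q; exact: poly_actD.
Qed.

Lemma poly_actC c v : poly_act c%:P v = c *: v.
Proof.
by rewrite (@poly_act_widen 1) ?size_polyC ?leq_b1// big_ord1 coefC.
Qed.

Lemma poly_actMX p v : poly_act (p * 'X) v = F (poly_act p v).
Proof.
rewrite (@poly_act_widen (size p).+1); last first.
  by rewrite (leq_trans (size_polyMleq _ _))// size_polyX addn2.
rewrite big_ord_recl coefMX eqxx scale0r add0r linear_sum.
by apply: eq_bigr => i _; rewrite coefMX linearZ.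
Qed.

Lemma poly_actXn n v : poly_act 'X^n v = iter n F v.
Proof.
by elim: n => [|n IHn]; rewrite ?poly_actC ?scale1r// exprSr poly_actMX IHn.
Qed.

Lemma poly_actM p q v : poly_act (p * q) v = poly_act p (poly_act q v).
Proof.
elim/poly_ind: p => [|p c IHp].
  by rewrite mul0r !poly_act0.
rewrite mulrDl mulrAC mul_polyC !poly_actD !poly_actMX IHp.
by rewrite poly_actZ poly_actC.
Qed.

Lemma poly_act_sub1 c p v :
  poly_act (p * ('X - c%:P)) v = F (poly_act p v) - c *: poly_act p v.
Proof.
by rewrite mulrBr poly_actD poly_actMX poly_actN mulrC mul_polyC poly_actZ.
Qed.

Lemma poly_actX p n v : poly_act (p ^+ n) v = iter n (poly_act p) v.
Proof.
elim: n => [|n IHn]; first by rewrite expr0 poly_actC scale1r.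
by rewrite exprS poly_actM IHn.
Qed.

Lemma poly_act_eigen p a v : F v = a *: v -> poly_act p v = p.[a] *: v.
Proof.
move=> Fv; elim/poly_ind: p => [|p c IHp].
  by rewrite poly_act0 horner0 scale0r.
rewrite poly_actD poly_actMX poly_actC IHp linearZ /= Fv.
by rewrite hornerD hornerM hornerX hornerC scalerDl scalerA.
Qed.

(** The difference p - p' vanishes at all the roots q^k of X^r - 1, hence is a multiple of X^r - 1,
    which annihilates F. *)
Lemma poly_act_eq r (q : K) p p' : r.-primitive_root q ->
  (forall v, iter r F v = v) ->
  (forall k, (k < r)%N -> p.[q ^+ k] = p'.[q ^+ k]) ->
  poly_act p =1 poly_act p'.
Proof.
move=> q_prim Fr pp' v; apply/eqP; rewrite -subr_eq0 -poly_actN -poly_actD.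
have /dvdpP[d ->] : 'X^r - 1 %| p - p'.
  rewrite -(factor_Xn_sub_1 q_prim).
  rewrite -(big_map (fun i => q ^+ i) predT (fun x => 'X - x%:P)).
  apply: uniq_roots_dvdp; last first.
    rewrite uniq_rootsE map_inj_in_uniq ?iota_uniq// => i j.
    rewrite !mem_index_iota /= => ir jr /eqP.
    by rewrite (eq_prim_root_expr q_prim) !modn_small// => /eqP.
  apply/allP => x /mapP[k]; rewrite mem_index_iota => /andP[_ kr] ->.
  by rewrite /root hornerD hornerN pp'// subrr.
rewrite poly_actM poly_actD poly_actXn Fr poly_actN.
by rewrite -polyC1 poly_actC scale1r subrr linear0.
Qed.

End PolyAction.

(** * Newton interpolation of the Gaussian q^k |-> q^(k choose 2) *)

Section GaussianPolynomial.
Variables (K : fieldType) (q : K).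

Definition newton (m : nat) : {poly K} := \prod_(j < m) ('X - (q ^+ j)%:P).

Lemma newtonS m : newton m.+1 = newton m * ('X - (q ^+ m)%:P).
Proof. exact: big_ord_recr. Qed.

Lemma horner_newton0 x : (newton 0).[x] = 1.
Proof. by rewrite /newton big_ord0 -polyC1 hornerC. Qed.

(** For j >= 1 the factor q x - q^j is q (x - q^(j-1)); only the factor j = 0 stays q x - 1. *)
Lemma newton_scale m x :
  (newton m.+1).[q * x] = q ^+ m * (q * x - 1) * (newton m).[x].
Proof.
elim: m => [|m IHm].
  by rewrite newtonS hornerM hornerXsubC !horner_newton0 expr0; ring.
by rewrite newtonS hornerM IHm [newton m.+1]newtonS !hornerM !hornerXsubC !exprS; ring.
Qed.

(* The coefficients solve the recurrence imposed by the functional equation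
   [f(q x) = x f(x)] of the Gaussian [f(q^k) = q^(k choose 2)]. *)
Definition gauss_coef (m : nat) : K :=
  \prod_(i < m) (q ^+ (2 * i).+1 * (q ^+ (2 * i).+2 - 1))^-1.

Definition gauss_poly (m : nat) : {poly K} :=
  \sum_(i < m) gauss_coef i *: newton (2 * i).

Hypothesis q_neq0 : q != 0.

(** The truncated sum misses the functional equation by one Newton term. The next even term cancels
    this defect and creates the following one; the nonvanishing condition keeps the inverses in
    [gauss_coef] genuine. *)
Lemma gauss_poly_scale m x :
  (forall i, (i < m)%N -> q ^+ (2 * i).+2 - 1 != 0) ->
  (gauss_poly m.+1).[q * x] - x * (gauss_poly m.+1).[x] =
  - gauss_coef m * (newton (2 * m).+1).[x].
Proof.
elim: m => [|m IHm] qm.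
  rewrite /gauss_poly big_ord1 /gauss_coef big_ord0 scale1r muln0 newtonS hornerM.
  by rewrite hornerXsubC !horner_newton0 expr0; ring.
rewrite /gauss_poly big_ord_recr -/(gauss_poly _) /= !hornerE.
have {}IHm := IHm (fun i im => qm i (leqW im)).
have cm : gauss_coef m = gauss_coef m.+1 * (q ^+ (2 * m).+1 * (q ^+ (2 * m).+2 - 1)).
  rewrite /gauss_coef [in RHS]big_ord_recr /= mulfVK// mulf_neq0 ?expf_neq0//.
  exact: qm.
move: IHm; rewrite mulnSr addn2 newton_scale !newtonS cm !(hornerM, hornerXsubC) !exprS.
set a := (gauss_poly _).[_]; set b := (gauss_poly _).[_] => IHm.
rewrite (_ : _ - _ = (a - x * b) + gauss_coef m.+1 *
  (q * q ^+ (2 * m) * (q * x - 1) * ((newton (2 * m)).[x] * (x - q ^+ (2 * m))) -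
   x * ((newton (2 * m)).[x] * (x - q ^+ (2 * m)) * (x - q * q ^+ (2 * m))))).
  by rewrite IHm; ring.
by ring.
Qed.

(** Truncation after i = (r - 1)/2 leaves as defect a multiple of [newton r], that is of X^r - 1,
    which vanishes at every q^k. So f(q^(k+1)) = q^k f(q^k) holds exactly, starting from f(1) =
    1. *)
Lemma gauss_polyE r k : r.-primitive_root q -> odd r ->
  (gauss_poly (r./2).+1).[q ^+ k] = q ^+ 'C(k, 2).
Proof.
move=> q_prim r_odd; have rE : (2 * r./2).+1 = r by lia.
elim: k => [|k IHk].
  have c0 : gauss_coef 0 = 1 by rewrite /gauss_coef big_ord0.
  rewrite /gauss_poly horner_sum big_ord_recl c0 scale1r horner_newton0 big1 ?addr0// => i _.
  (* Every nonconstant Newton term contains the factor X - 1. *)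
  rewrite hornerZ lift0 mulnSr addn2 /newton big_ord_recl hornerM hornerXsubC.
  by rewrite expr0 subrr mul0r mulr0.
have := @gauss_poly_scale r./2 (q ^+ k); rewrite rE -exprS IHk.
have -> : (newton r).[q ^+ k] = 0.
  rewrite /newton -(big_mkord predT (fun j => 'X - (q ^+ j)%:P)).
  rewrite (factor_Xn_sub_1 q_prim) !hornerE -exprM mulnC exprM.
  by rewrite (prim_expr_order q_prim) expr1n subrr.
rewrite mulr0 => /(_ _)/subr0_eq-> => [|i ir].
  by rewrite -exprD binS bin1 addnC.
rewrite subr_eq0 -(prim_order_dvd q_prim) gtnNdvd//; lia.
Qed.

End GaussianPolynomial.

(** * Exponents in Z/r, shifts and diagonal operators *)

Section Operators.
Variables (K : fieldType) (g r : nat) (z : K).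
Hypotheses (r_odd : odd r) (r_gt1 : (1 < r)%N) (z_prim : r.-primitive_root z).

Local Notation V := (Vg K g r).

Lemma zpow_nat k : zpow z (k%:R : 'Z_r) = z ^+ k.
Proof. by rewrite /zpow val_Zp_nat// (prim_expr_mod z_prim). Qed.

Lemma zpowD (a b : 'Z_r) : zpow z (a + b) = zpow z a * zpow z b.
Proof. by rewrite -[a]natr_Zp -[b]natr_Zp -natrD !zpow_nat exprD. Qed.

Lemma zpow0 : zpow z (0 : 'Z_r) = 1.
Proof. by rewrite (zpow_nat 0). Qed.

Lemma zpow_neq0 (a : 'Z_r) : zpow z a != 0.
Proof. by rewrite expf_neq0 ?(prim_root_neq0 z_prim). Qed.

Lemma zpowX_order (a : 'Z_r) : zpow z a ^+ r = 1.
Proof. by rewrite /zpow exprAC (prim_expr_order z_prim) expr1n. Qed.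

Lemma zpowX (a : 'Z_r) k : zpow z a ^+ k = zpow z (a * k%:R).
Proof. by rewrite -[a]natr_Zp -natrM !zpow_nat exprM. Qed.

Lemma zpow_int (m : int) : zpow z (m%:~R : 'Z_r) = z ^ m.
Proof.
case: m => n; first by rewrite -pmulrn zpow_nat.
rewrite NegzE mulrNz -pmulrn -exprnN -zpow_nat; set a := _%:R.
have e : zpow z (- a) * zpow z a = 1 by rewrite -zpowD addNr zpow0.
by apply: (mulIf (zpow_neq0 a)); rewrite e mulVf ?zpow_neq0.
Qed.

Lemma zpow4 (a : 'Z_r) : zpow z (4 * a) = (z ^+ 4) ^+ a.
Proof. by rewrite -[a in LHS]natr_Zp -[4]/(4%:R) -natrM zpow_nat exprM. Qed.

Lemma egE (n m : idx g r) : eg K n m = (m == n)%:R.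
Proof.
rewrite ffunE; under eq_bigr do rewrite ffunE.
have [->|/eqP mn] := eqVneq m n; first by rewrite big1// => j _; rewrite eqxx.
have [j mj] : exists j, m j != n j.
  by apply/existsP; apply: contra_notT mn; rewrite negb_exists => /forallP mn;
    apply/ffunP => j; apply/eqP; have := mn j; rewrite negbK.
by rewrite (bigD1 j)//= (negPf mj) mul0r.
Qed.

Lemma eg_decomp (v : V) : v = \sum_n v n *: eg K n.
Proof.
apply/ffunP => m; rewrite sum_ffunE (bigD1 m)//= ffunE egE eqxx big1.
  by rewrite addr0 -[LHS]mulr1.
by move=> n nm; rewrite ffunE egE eq_sym (negPf nm); exact: mulr0.
Qed.

Lemma linear_eq_eg (F G : {linear V -> V}) :
  (forall n, F (eg K n) = G (eg K n)) -> F =1 G.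
Proof.
move=> FG v; rewrite [v]eg_decomp !linear_sum; apply: eq_bigr => n _.
by rewrite !linearZ /= FG.
Qed.

Lemma set_index_id (n : idx g r) j : set_index n j (n j) = n.
Proof. by apply/ffunP => i; rewrite ffunE; case: eqP => // ->. Qed.

Lemma set_index_set_index (n : idx g r) j a b :
  set_index (set_index n j a) j b = set_index n j b.
Proof. by apply/ffunP => i; rewrite !ffunE; case: eqP. Qed.

Lemma set_index_at (n : idx g r) j a : set_index n j a j = a.
Proof. by rewrite ffunE eqxx. Qed.

Definition set_indexE := (set_index_set_index, set_index_at).

Lemma iter_vshift (j : 'I_g) k (v : V) m :
  iter k (vshift j) v m = v (set_index m j (m j - k%:R)) :> K.
Proof.
elim: k m => [|k IHk] m /=; first by rewrite subr0 set_index_id.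
by rewrite ffunE IHk !set_indexE -natr1 opprD addrAC addrA.
Qed.

Lemma iter_vshift_order j (v : V) : iter r (vshift j) v = v.
Proof.
by apply/ffunP => m; rewrite iter_vshift pchar_Zp// subr0 set_index_id.
Qed.

Lemma iter_vshift_eg (j : 'I_g) k (n : idx g r) :
  iter k (vshift j) (eg K n) = eg K (set_index n j (n j + k%:R)).
Proof.
apply/ffunP => m; rewrite iter_vshift !egE; congr (_ %:R); congr nat_of_bool.
by apply/eqP/eqP => [<-|->]; rewrite !set_indexE ?addrK ?subrK set_index_id.
Qed.

(** The factor 4 makes q^(d(n)), with q = z^4, the eigenvalue at e_n, as in the action of
    alpha_j. *)
Definition diag (d : idx g r -> 'Z_r) (v : V) : V :=
  [ffun n => zpow z (4 * d n) * v n].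

Lemma diag_is_linear d : linear (diag d).
Proof. by move=> c u v; apply/ffunP => n; rewrite !ffunE mulrDr mulrCA. Qed.

HB.instance Definition _ d :=
  GRing.isLinear.Build K V V _ (diag d) (diag_is_linear d).

Lemma diag_eg d n : diag d (eg K n) = (z ^+ 4) ^+ d n *: eg K n.
Proof.
apply/ffunP => m; rewrite [LHS]ffunE [RHS]ffunE egE.
by have [->|mn] := eqVneq m n; rewrite ?zpow4// mulr0 scaler0.
Qed.

Lemma iter_diag_order d (v : V) : iter r (diag d) v = v.
Proof.
apply/ffunP => n; have -> k : iter k (diag d) v n = zpow z (4 * d n) ^+ k * v n :> K.
  by elim: k => [|k IHk]; rewrite ?mul1r// iterS ffunE IHk exprS mulrA.
by rewrite zpowX_order mul1r.
Qed.

(** The increment of d along the coordinate j is a constant a, so the operator commutes with x_j up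
    to the factor q^a, as [raises_diagonal] demands. *)
Lemma raises_diag d : d [ffun=> 0] = 0 ->
  (forall j, exists a, forall n, d n = d (set_index n j (n j - 1)) + a) ->
  raises z (diag d).
Proof.
move=> d0 dshift; apply: (raises_diagonal r_odd r_gt1 z_prim) => [n n0|j].
  (* In degree 0 this is the basis vector at the zero index, since t_0 = v_0. *)
  have -> : t_tensor z n = eg K [ffun=> 0].
    have n0j j : n j = 0%N :> nat.
      by apply/eqP; move/eqP: n0; rewrite sum_nat_eq0 => /forallP/(_ j).
    apply/ffunP => m; rewrite !ffunE; apply: eq_bigr => j _.
    rewrite n0j /t_vec big_ord1 -/(t_coef z 0 0) (t_coefnn r_odd r_gt1 z_prim).
      by rewrite scale1r !ffunE.
    exact: ltnW.
  by rewrite /= diag_eg d0 scale1r.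
have [a da] := dshift j; exists (4 * a : 'Z_r)%R => v.
apply/ffunP => m; rewrite !ffunE da mulrDr zpowD -mulrA mulrCA.
by [].
Qed.

End Operators.

(** * Invariance of the lattice under each generator *)

Section Invariance.
Variables (K : fieldType) (g r : nat) (z : K).
Hypotheses (r_odd : odd r) (r_prime : prime r) (z_prim : r.-primitive_root z).

Local Notation V := (Vg K g r).
Local Notation q := (z ^+ 4).

Let r_gt1 : (1 < r)%N := prime_gt1 r_prime.
Let z1 : 1 - z != 0 := sub1_prim_root_neq0 r_gt1 z_prim.
Let z0 : z != 0 := prim_root_neq0 z_prim.

Let coprime4 : coprime 4 r.
Proof. by rewrite -[4%N]/(2 ^ 2)%N coprimeXl// coprime2n. Qed.

Lemma prim_root_exp4 : r.-primitive_root q.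
Proof. by rewrite (prim_root_exp_coprime _ z_prim). Qed.

Lemma in_Zz_inv_exp n : in_Zz z (z ^+ n)^-1.
Proof.
have -> : (z ^+ n)^-1 = z ^+ (n * r.-1).
  apply: (mulfI (expf_neq0 n z0)); rewrite divff ?expf_neq0// -exprD -mulnS.
  by rewrite prednK ?prime_gt0// mulnC exprM (prim_expr_order z_prim) expr1n.
by apply: in_ZzX; exact: in_Zz_gen.
Qed.

(** Each of the i factors is a power of z times the inverse of some q^(2k+2) - 1 with 2k + 2 < r. As
    r is an odd prime, 4 (2k + 2) is coprime to r, so this inverse has weight -2. *)
Lemma wt_gauss_coef i : (2 * i < r)%N -> wt z (- (2 * i)%:Z) (gauss_coef q i).
Proof.
elim: i => [|i IHi] ir; rewrite /gauss_coef ?big_ord0.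
  by rewrite muln0; apply: wt_in_Zz; exact: in_Zz1.
rewrite big_ord_recr -/(gauss_coef q i) (_ : - _ = - (2 * i)%:Z + (0 - 2)); last by lia.
apply: wtM => //; first by apply: IHi; lia.
rewrite invfM; apply: wtM => //.
  by rewrite -exprM; apply: wt_in_Zz; exact: in_Zz_inv_exp.
rewrite -opprB invrN; apply: wtN; rewrite -exprM; apply: (wt_inv_sub1X z1 z_prim).
rewrite coprimeMl coprime4 coprime_sym prime_coprime//.
by rewrite gtnNdvd//=; lia.
Qed.

Lemma filtration_newton (F : {linear V -> V}) m s v : raises z F ->
  filtration z s v -> filtration z (s + m%:Z) (poly_act F (newton q m) v).
Proof.
move=> rF Mv; elim: m => [|m IHm].
  by rewrite /newton big_ord0 addr0 -polyC1 poly_actC scale1r.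
rewrite newtonS poly_act_sub1 -exprM (_ : s + _ = s + m%:Z + 1); last by lia.
exact: (raises_sub r_gt1 z_prim).
Qed.

(** The 2i units gained from the 2i factors of [newton q (2 * i)] make up for those lost to the i-th
    coefficient. *)
Lemma filtration_gauss (F : {linear V -> V}) v : raises z F ->
  filtration z 0 v -> filtration z 0 (poly_act F (gauss_poly q (r./2).+1) v).
Proof.
move=> rF Mv; rewrite poly_act_sum; apply: (filtration_sum r_gt1 z_prim) => i _.
rewrite poly_actZ (_ : 0 = - (2 * i)%:Z + (0 + (2 * i)%:Z)); last by lia.
apply: filtrationZ => //; last exact: filtration_newton.
by apply: wt_gauss_coef; have := ltn_ord i; lia.
Qed.

(** For an integer a, -|n| <= 2a means a >= -floor(|n|/2): the rounding built into [wt] reproduces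
    the floor in the exponents of the basis. *)
Lemma lattice'E v : lattice' g r z v <-> filtration z 0 v.
Proof.
split=> [[c Oc ->]|[c wc ->]].
  exists (fun n => c n * (1 - z) ^- (degree n)./2) => [n|]; last first.
    by apply: eq_bigr => n _; rewrite /v'_vec scalerA.
  rewrite mulrC; exists (- ((degree n)./2)%:Z); first by lia.
  by exists (c n) => //; rewrite exprnN.
exists (fun n => c n * (1 - z) ^+ (degree n)./2) => [n|]; last first.
  apply: eq_bigr => n _; rewrite /v'_vec scalerA -mulrA divff ?mulr1//.
  exact: expf_neq0.
have [a na [u Ou ->]] := wc n.
rewrite mulrAC exprnP -expfzDr// (_ : a + _ = `|(a + (degree n)./2%:Z)%R|%N); last by lia.
apply: in_ZzM => //; apply: in_ZzX.
by apply: in_ZzD; [exact: in_Zz1|apply: in_ZzN; exact: in_Zz_gen].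
Qed.

(** The iterate [iter N.-1 h v] is a preimage of v in L, so for maps of finite order one inclusion
    suffices. *)
Lemma image_finite_order (T : Type) (L : set T) (h : T -> T) N : (0 < N)%N ->
  (forall v, L v -> L (h v)) -> (forall v, iter N h v = v) -> h @` L = L.
Proof.
case: N => // N _ Lh hN; apply/seteqP; split=> [_ [v Lv <-]|v Lv]; first exact: Lh.
exists (iter N h v); last exact: hN.
by elim: N {hN} => //= N IHN; exact: Lh.
Qed.

Lemma raises_image (h : V -> V) (F : {linear V -> V}) : raises z F ->
  (forall v, iter r F v = v) -> h =1 F -> h @` lattice' g r z = lattice' g r z.
Proof.
move=> rF Fr /funext ->; apply: image_finite_order Fr; first exact: prime_gt0.
by move=> v /lattice'E Lv; apply/lattice'E; exact: (raises_filtration r_gt1 z_prim).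
Qed.

(** The exponent e is 1 for the diagonal twists and 0 for the twists along beta_j. *)
Lemma gauss_image (h : V -> V) (F : {linear V -> V}) e : raises z F ->
  (forall v, iter r F v = v) ->
  h =1 poly_act F ('X^e * gauss_poly q (r./2).+1) ->
  h @` lattice' g r z = lattice' g r z.
Proof.
move=> rF Fr /funext ->; apply: (@image_finite_order _ _ _ r).
- exact: prime_gt0.
- move=> v /lattice'E Lv; apply/lattice'E; rewrite poly_actM poly_actXn.
  by elim: e => [|e IHe] /=; [exact: filtration_gauss|exact: (raises_filtration r_gt1 z_prim)].
(* The r-th power of the polynomial takes the value 1 at every q^k, so the r-th power of the
   operator is the identity. *)
- move=> v; rewrite -poly_actX (poly_act_eq prim_root_exp4 Fr (p' := 1)).
    by rewrite -polyC1 poly_actC scale1r.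
  move=> k _; rewrite horner_exp hornerM hornerXn gauss_polyE ?prim_root_exp4//.
    have qr i : q ^+ i ^+ r = 1.
      by rewrite exprAC (prim_expr_order prim_root_exp4) expr1n.
    by rewrite -polyC1 hornerC exprMn -[q ^+ k ^+ e]exprM !qr mulr1.
  by rewrite expf_neq0.
Qed.

Lemma zpow_binomial2 (k : nat) :
  zpow z (2 * (k%:R - 1) * k%:R : 'Z_r) = q ^+ 'C(k, 2).
Proof.
elim: k => [|k IHk]; first by rewrite mulr0 (zpow0 r_gt1 z_prim) expr0.
rewrite binS bin1 exprD -IHk mulrC -exprM -(zpow_nat r_gt1 z_prim).
rewrite -(zpowD r_gt1 z_prim) natrM -natr1; congr (zpow _ _); ring.
Qed.

(** The exponent 2r allows for the sign in the scalar -z^(-2) of sigma. *)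
Lemma scalar_image (h : V -> V) c : in_Zz z c -> c ^+ (2 * r) = 1 ->
  h =1 *:%R c -> h @` lattice' g r z = lattice' g r z.
Proof.
move=> Oc c1 /funext ->; apply: (@image_finite_order _ _ _ (2 * r)).
- by rewrite muln_gt0 (prime_gt0 r_prime).
- move=> v /lattice'E Lv; apply/lattice'E; rewrite -[0]add0r.
  by apply: filtrationZ => //; exact: wt_in_Zz.
- move=> v; rewrite -[RHS]scale1r -c1; elim: (2 * r)%N => [|n IHn].
    by rewrite expr0 scale1r.
  by rewrite iterS IHn scalerA -exprS.
Qed.

Lemma sigma_invariant (h : GL V) : basis_image h (sigma_image z) ->
  (fun v => h v) @` lattice' g r z = lattice' g r z.
Proof.
move=> hE; apply: (@scalar_image _ (- z ^- 2)).
- by apply: in_ZzN; exact: in_Zz_inv_exp.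
- rewrite exprM sqrrN !exprVn -!exprM mulnA mulnC exprM (prim_expr_order z_prim).
  by rewrite expr1n invr1.
- by apply: linear_eq_eg => n; rewrite /= hE.
Qed.

Lemma raises_diag_coord j : raises z (diag z (fun n : idx g r => n j)).
Proof.
apply: raises_diag => //; first by rewrite ffunE.
move=> i; exists (i == j)%:R => n; rewrite ffunE eq_sym.
by case: eqP => [->|_]; rewrite ?subrK ?addr0.
Qed.

Lemma raises_diag_diff k l :
  raises z (diag z (fun n : idx g r => n k - n l)).
Proof.
apply: raises_diag => //; first by rewrite !ffunE subrr.
move=> i; exists ((i == k)%:R - (i == l)%:R) => n; rewrite !ffunE ![_ == i]eq_sym.
by case: eqP => [->|_]; case: eqP => [->|_]; rewrite /=; ring.
Qed.

Lemma alpha_invariant j (h : GL V) : basis_image h (alpha_image z j) ->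
  (fun v => h v) @` lattice' g r z = lattice' g r z.
Proof.
move=> hE; apply: (raises_image (@raises_diag_coord j)).
  exact: iter_diag_order.
by apply: linear_eq_eg => n; rewrite /= hE diag_eg// -zpow4.
Qed.

Lemma beta_invariant j (h : GL V) : basis_image h (beta_image K j) ->
  (fun v => h v) @` lattice' g r z = lattice' g r z.
Proof.
move=> hE; apply: (raises_image (raises_vshift r_odd r_gt1 z_prim j)).
  exact: iter_vshift_order.
by apply: linear_eq_eg => n; rewrite /= hE; apply/esym; exact: (iter_vshift_eg K j 1 n).
Qed.

(** Since 2 (d + 1) d = 4 d + 2 (d - 1) d, the eigenvalue is q^d times the Gaussian at q^d: the
    operator is D f(D). *)
Lemma diag_gauss_invariant d (h : GL V) : raises z (diag z d) ->
  basis_image h (fun n => zpow z (2 * (d n + 1) * d n) *: eg K n) ->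
  (fun v => h v) @` lattice' g r z = lattice' g r z.
Proof.
move=> rd hE; apply: (gauss_image (e := 1) rd); first exact: iter_diag_order.
apply: linear_eq_eg => n; rewrite /= hE (poly_act_eigen _ (diag_eg _ _ _ _))//.
rewrite hornerM hornerX gauss_polyE ?prim_root_exp4 ?expf_neq0//.
congr (_ *: _); rewrite -zpow_binomial2 natr_Zp -zpow4// -zpowD//.
by congr (zpow _ _); ring.
Qed.

Lemma tau_alpha_invariant j (h : GL V) : basis_image h (tau_alpha_image z j) ->
  (fun v => h v) @` lattice' g r z = lattice' g r z.
Proof. exact: (diag_gauss_invariant (@raises_diag_coord j)). Qed.

Lemma tau_gamma_invariant k l (h : GL V) : basis_image h (tau_gamma_image z k l) ->
  (fun v => h v) @` lattice' g r z = lattice' g r z.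
Proof. exact: (diag_gauss_invariant (@raises_diag_diff k l)). Qed.

Lemma G1_zpow : G1 r z = \sum_(l : 'Z_r) zpow z (- (2 * l * (l - 1))).
Proof.
rewrite /G1 -(big_mkord predT (fun l : nat => z ^ (- 2 * l%:Z * (l%:Z - 1)))).
rewrite -{1}(Zp_cast r_gt1) big_mkord; apply: eq_bigr => l _.
rewrite -(zpow_int r_gt1 z_prim); congr (zpow _ _).
rewrite !rmorphM rmorphN rmorphB /= -!pmulrn natr_Zp rmorph1.
by ring.
Qed.

Lemma tau_beta_invariant j (h : GL V) : basis_image h (tau_beta_image z j) ->
  (fun v => h v) @` lattice' g r z = lattice' g r z.
Proof.
move=> hE.
(* The Gauss sum is nonzero because h is injective: otherwise its inverse would be 0 by convention
   and h would kill a basis vector. *)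
have G1_neq0 : G1 r z != 0.
  pose n : idx g r := [ffun=> 0]; apply/eqP => G10.
  have : eg K n = 0.
    apply: (lker0P (GL_lker h)); rewrite hE linear0 /tau_beta_image G10 invr0.
    by rewrite scale0r.
  by move/ffunP/(_ n)/eqP; rewrite egE eqxx ffunE oner_eq0.
apply: (gauss_image (e := 0) (raises_vshift r_odd r_gt1 z_prim j)).
  exact: iter_vshift_order.
(* With l = m - n_j the formula for the twist reads p(x_j). *)
pose p := (G1 r z)^-1 *: \sum_(l : 'Z_r) zpow z (- (2 * (l + 1) * l)) *: 'X^l.
move=> v; rewrite expr0 mul1r -(poly_act_eq prim_root_exp4 _ (p := p)).
- move: v; apply: linear_eq_eg => n; rewrite /= hE poly_actZ poly_act_sum.
  congr (_ *: _); rewrite (reindex (fun l => n j + l)) /=; last first.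
    by exists (fun m => m - n j) => l _; rewrite ?(addrC (n j)) ?addrK ?subrK.
  apply: eq_bigr => l _; rewrite poly_actZ poly_actXn iter_vshift_eg// natr_Zp.
  by rewrite (addrC (n j)) addrK.
- by move=> w; exact: iter_vshift_order.
- move=> k _; rewrite gauss_polyE ?prim_root_exp4 ?expf_neq0//.
  rewrite hornerZ horner_sum; apply: (mulfI G1_neq0); rewrite mulVKf//.
  rewrite (eq_bigr (fun l => zpow z (- (2 * (l + 1) * l) + 4 * l * k%:R))).
    (* The reflection l |-> k - l completes the square: the exponent becomes 2 (k - 1) k - 2 l (l -
       1), which gives the Gaussian value times a term of the Gauss sum. *)
    rewrite G1_zpow mulr_suml (reindex (fun l : 'Z_r => k%:R - l)).
      apply: eq_bigr => l _; rewrite -zpow_binomial2 -zpowD//.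
      by congr (zpow _ _); ring.
    by exists (fun l => k%:R - l) => l _; rewrite opprB addrC subrK.
  move=> l _; rewrite hornerZ hornerXn [q ^+ k ^+ _]exprAC -zpow4//.
  by rewrite zpowX// -zpowD.
Qed.

End Invariance.

(** * Primitivity of the root of unity e^(2 pi i / r) *)

Section RootOfUnity.
Variables (R : realType) (r : nat).

Lemma zetaCX k : zetaC R r ^+ k =
  Complex (cos (k%:R * (2 * pi / r%:R))) (sin (k%:R * (2 * pi / r%:R))).
Proof.
elim: k => [|k IHk]; first by rewrite mul0r cos0 sin0.
rewrite exprSr IHk /zetaC -[k.+1]addn1; set t := 2 * pi / _.
rewrite natrD mulrDl mul1r cosD sinD; simpc.
by congr (_ +i* _)%C; ring.
Qed.

(** The order divides the prime r, and it is not 1 because sin(2 pi / r) > 0; the bound r >= 3 puts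
    the angle below pi. *)
Lemma zeta_prim : prime r -> (3 <= r)%N -> r.-primitive_root (zeta R r).
Proof.
move=> r_prime r3; have r0 : (r%:R : R) != 0 by rewrite pnatr_eq0; lia.
have z_order : zeta R r ^+ r = 1.
  apply: val_inj; rewrite rmorphXn rmorph1 /= zetaCX mulrC divfK//.
  by rewrite mulr_natl cos2pi sin2pi.
have [m zm] := prim_order_exists (prime_gt0 r_prime) z_order.
have /primeP[_ dvd_r] := r_prime.
move=> /dvd_r/orP[/eqP m1|/eqP mr]; last by move: zm; rewrite mr.
have : zeta R r = 1 by rewrite -[LHS]expr1 -m1 prim_expr_order.
move/(congr1 (fun x => complex.Im (val x))); rewrite /= => s0.
have rp : (0 : R) < r%:R by rewrite ltr0n prime_gt0.
have : 0 < sin (2 * pi / r%:R : R).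
  apply: sin_gt0_pi; apply/andP; split; first by rewrite divr_gt0// mulr_gt0 ?pi_gt0.
  by rewrite ltr_pdivrMr// mulrC ltr_pM2l ?pi_gt0// ltr_nat.
by rewrite s0 ltxx.
Qed.

End RootOfUnity.

(** * Units and inverses under group morphisms *)

Section GroupMorphism.
Variables (G H : groupType) (f : {multiplicative G -> H}).

Lemma multiplicative1 : f 1%g = 1%g.
Proof. by apply: (@mulgI _ (f 1%g)); rewrite -gmulfM !mulg1. Qed.

Lemma multiplicativeV x : f (x^-1)%g = ((f x)^-1)%g.
Proof.
by apply/esym/mulg1_eq; rewrite -gmulfM mulgV multiplicative1.
Qed.

End GroupMorphism.

(** * From the generators to the whole groups *)

Unset Implicit Arguments.

Theorem theorem9p1 (R : realType) (g r : nat)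
  (g_ge1 : (1 <= g)%N) (r_ge3 : (3 <= r)%N) (r_odd : odd r) (r_prime : prime r)
  (phi : {multiplicative Heis g -> GL (Vg (Qzeta R r) g r)})
  (phi_action : heis_action (zeta R r) phi)
  (Mod_generated : generated_by (lickorish_twists R g))
  (psi : {multiplicative Mod R g -> PGL (Vg (Qzeta R r) g r)})
  (psi_action : mod_action (zeta R r) psi) :
  (forall x : Heis g,
     (fun v => phi x v) @` lattice' g r (zeta R r) = lattice' g r (zeta R r)) /\
  (forall f : Mod R g, exists2 h : GL (Vg (Qzeta R r) g r),
     psi f = to_PGL h &
     (fun v => h v) @` lattice' g r (zeta R r) = lattice' g r (zeta R r)).
Proof.
have z_prim := zeta_prim R r_prime r_ge3.
set L := lattice' g r (zeta R r).
have imageE (h : GL (Vg (Qzeta R r) g r)) f : h =1 f -> (fun v => h v) @` L = f @` L.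
  by move=> /funext hf; rewrite -hf.
(* This and the next two facts say that the stabilizer of L in [GL] is a subgroup. *)
have L1 : (fun v => (1%g : GL (Vg (Qzeta R r) g r)) v) @` L = L.
  by rewrite (imageE _ id) ?image_id// => v; exact: id_lfunE.
have LM (h k : GL (Vg (Qzeta R r) g r)) : (fun v => h v) @` L = L ->
    (fun v => k v) @` L = L -> (fun v => (h * k)%g v) @` L = L.
  move=> hL kL; rewrite (imageE _ (fun v => h (k v))) => [|v]; last exact: comp_lfunE.
  by rewrite -[RHS]hL -[in RHS]kL image_comp.
have LV (h : GL (Vg (Qzeta R r) g r)) : (fun v => h v) @` L = L ->
    (fun v => (h^-1)%g v) @` L = L.
  move=> hL; rewrite -[in LHS]hL image_comp -[RHS]image_id; congr (_ @` _).
  by apply/funext => v; exact: (lker0_lfunK (GL_lker h)).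
split=> [x|].
  rewrite -(pg_classK x); case: phi_action => phi_s phi_a phi_b.
  (* Induction on a term representing x, whose leaves are the generators and the unit. *)
  elim: (repr x) => [[|j|j]||t IHt t' IHt'|t IHt].
  - exact: (sigma_invariant r_odd r_prime z_prim).
  - exact: (alpha_invariant r_odd r_prime z_prim (phi_a j)).
  - exact: (beta_invariant r_odd r_prime z_prim (phi_b j)).
  - rewrite (_ : pg_class _ = 1%g)// multiplicative1; exact: L1.
  - by rewrite (pg_classM (P := heis_pregroup g)) gmulfM; exact: LM.
  - by rewrite (pg_classV (P := heis_pregroup g)) multiplicativeV; exact: LV.
(* The classes with a representative stabilizing L form a subgroup; it contains the Lickorish
   twists, so [Mod_generated] makes it everything. *)
pose S : set (Mod R g) := [set f | exists2 h : GL (Vg (Qzeta R r) g r),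
  psi f = to_PGL h & (fun v => h v) @` L = L].
suff ST : S = setT by move=> f; have : S f by rewrite ST.
have [tau_a tau_b tau_g] := psi_action; apply: Mod_generated.
- by exists 1%g => //; rewrite multiplicative1.
- move=> f f' [h ph hL] [h' ph' h'L]; exists (h * h')%g; last exact: LM.
  by rewrite gmulfM ph ph' /to_PGL -pg_classM.
- move=> f [h ph hL]; exists (h^-1)%g; last exact: LV.
  by rewrite multiplicativeV ph /to_PGL -pg_classV.
- move=> _ [f -> [[j fj]|[j fj]|[k [l [kl fkl]]]]].
  + have [h ph hE] := tau_a j f fj; exists h => //.
    exact: (tau_alpha_invariant r_odd r_prime z_prim hE).
  + have [h ph hE] := tau_b j f fj; exists h => //.
    exact: (tau_beta_invariant r_odd r_prime z_prim hE).
  + have [h ph hE] := tau_g k l f kl fkl; exists h => //.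
    exact: (tau_gamma_invariant r_odd r_prime z_prim hE).
Qed.
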